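(* For any two given positive integers $t,\ell$ there exists $n_0=n_0(t,\ell)$ such that for all $n\ge n_0$, the graph $K_{t-1}+T_{n-t+1,2}$ is the unique (up to isomorphism) extremal graph with respect to $spex(n,tC_{2\ell+1})$; that is, it is the unique $n$-vertex $tC_{2\ell+1}$-free graph with maximum spectral radius.
   Context: All graphs are finite and simple. A graph is $F$-free if it contains no (not necessarily induced) subgraph isomorphic to $F$. $\rho(G)$ is the spectral radius of the adjacency matrix of $G$. $spex(n,F)$ is the maximum of $\rho(G)$ over all $n$-vertex $F$-free graphs $G$; an $n$-vertex $F$-free graph attaining it is called extremal with respect to $spex(n,F)$. $C_k$ is the cycle of length $k$, and $tF$ is the disjoint union of $t$ copies of $F$. $K_m$ is the complete graph on $m$ vertices ($K_0$ is empty), $T_{m,2}$ is the complete bipartite graph on $m$ vertices whose two parts have sizes differing by at most one, and $F+H$ denotes the join of $F$ and $H$ (so for $t=1$ the graph is $T_{n,2}$). *)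

(* Defs.v *)
From HB Require Import structures.
From mathcomp Require Import all_boot all_order all_algebra all_field.

Set Implicit Arguments.
Unset Strict Implicit.
Unset Printing Implicit Defensive.

Import Order.TTheory GRing.Theory Num.Theory.

(* [edges G] contains both orientations of every edge, so that two graphs on
   the same vertex set are equal iff they have the same edges, and the graphs
   on a given finite vertex set form a finite type. *)
Record sgraph (V : finType) := SGraph {
  edges : {set V * V};
  _ : [forall x, (x, x) \notin edges] &&
      [forall x, forall y, ((x, y) \in edges) == ((y, x) \in edges)]
}.

HB.instance Definition _ (V : finType) := [isSub for @edges V].
HB.instance Definition _ (V : finType) := [Finite of sgraph V by <:].

Definition adj (V : finType) (G : sgraph V) : rel V :=
  fun x y => (x, y) \in edges G.

Lemma adj_irrefl (V : finType) (G : sgraph V) : irreflexive (adj G).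
Proof. by case: G => E EP x; apply/negbTE; have /andP[/forallP/(_ x)] := EP. Qed.

Lemma adj_sym (V : finType) (G : sgraph V) : symmetric (adj G).
Proof.
by case: G => E EP x y; have /andP[_ /forallP/(_ x)/forallP/(_ y)/eqP] := EP.
Qed.

Lemma sgraph_of_rel_subproof (V : finType) (r : rel V)
    (E := [set p : V * V | (p.1 != p.2) && (r p.1 p.2 || r p.2 p.1)]) :
  [forall x, (x, x) \notin E] &&
  [forall x, forall y, ((x, y) \in E) == ((y, x) \in E)].
Proof.
apply/andP; split; apply/forallP => x; first by rewrite inE /= eqxx.
by apply/forallP => y; rewrite !inE /= (eq_sym x y) orbC.
Qed.

(* Distinct x and y are adjacent iff r x y or r y x. *)
Definition sgraph_of_rel (V : finType) (r : rel V) : sgraph V :=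
  SGraph (sgraph_of_rel_subproof r).

Lemma adj_of_rel (V : finType) (r : rel V) x y :
  adj (sgraph_of_rel r) x y = (x != y) && (r x y || r y x).
Proof. by rewrite /adj inE. Qed.

Definition sgraph_iso (V W : finType) (G : sgraph V) (H : sgraph W) : Prop :=
  exists2 f : V -> W, bijective f & forall x y, adj H (f x) (f y) = adj G x y.

(* G has a not necessarily induced subgraph isomorphic to F. *)
Definition contains (U V : finType) (F : sgraph U) (G : sgraph V) : bool :=
  [exists f : {ffun U -> V}, injectiveb f &&
     [forall x, forall y, adj F x y ==> adj G (f x) (f y)]].

Definition free (U V : finType) (F : sgraph U) (G : sgraph V) : bool :=
  ~~ contains F G.

Definition complete_graph (m : nat) : sgraph 'I_m :=
  sgraph_of_rel (fun _ _ => true).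

Definition empty_graph (m : nat) : sgraph 'I_m :=
  sgraph_of_rel (fun _ _ => false).

(* [ordS] is the successor modulo k; this is the k-cycle for k >= 3 only. *)
Definition cycle_graph (k : nat) : sgraph 'I_k :=
  sgraph_of_rel (fun i j => j == ordS i).

Definition copies (t : nat) (V : finType) (F : sgraph V) : sgraph ('I_t * V)%type :=
  sgraph_of_rel (fun u v => (u.1 == v.1) && adj F u.2 v.2).

Definition join (V W : finType) (G : sgraph V) (H : sgraph W) :
    sgraph (V + W)%type :=
  sgraph_of_rel (fun u v =>
    match u, v with
    | inl x, inl y => adj G x y
    | inr x, inr y => adj H x y
    | _, _ => true
    end).

Definition complete_bipartite (a b : nat) : sgraph ('I_a + 'I_b)%type :=
  join (empty_graph a) (empty_graph b).

Definition turan2 (m : nat) : sgraph ('I_(m./2) + 'I_(uphalf m))%type :=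
  complete_bipartite m./2 (uphalf m).

Local Open Scope ring_scope.

Definition adjmx (V : finType) (G : sgraph V) : 'M[algC]_#|V| :=
  \matrix_(i, j) (adj G (enum_val i) (enum_val j))%:R.

(* The complex eigenvalues with multiplicity. For an integer matrix they are
   algebraic numbers, so nothing is lost by working over algC. *)
Definition eigenvalues (n : nat) (A : 'M[algC]_n) : seq algC :=
  sval (closed_field_poly_normal (char_poly A)).

Lemma mem_eigenvalues (n : nat) (A : 'M[algC]_n) z :
  (z \in eigenvalues A) = eigenvalue A z.
Proof.
rewrite /eigenvalues eigenvalue_root_char.
case: closed_field_poly_normal => s /=.
by rewrite (monicP (char_poly_monic A)) scale1r => ->; rewrite root_prod_XsubC.
Qed.

(* The moduli are nonnegative reals, hence comparable in algC; the default
   value 0 only matters for n = 0. *)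
Definition spectral_radius (n : nat) (A : 'M[algC]_n) : algC :=
  \big[Num.max/0]_(z <- eigenvalues A) `|z|.

Definition rho (V : finType) (G : sgraph V) : algC :=
  spectral_radius (adjmx G).

(* The default value 0 only matters when no graph on n vertices is F-free. *)
Definition spex (n : nat) (U : finType) (F : sgraph U) : algC :=
  \big[Num.max/0]_(G : sgraph 'I_n | free F G) rho G.

Definition extremal (n : nat) (U : finType) (F : sgraph U)
    (V : finType) (G : sgraph V) : Prop :=
  [/\ #|V| = n, free F G & rho G = spex n F].

(* Main.v *)
Require Import Defs.
From mathcomp Require Import all_boot all_order all_algebra all_field.
From mathcomp Require Import zify ring lra.

(** Let G be extremal, k = 2l+1, and let x >= 0 be a Perron vector of G for
    rho = rho(G).  Comparing with a balanced complete bipartite graph gives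
    rho >= (n-1)/2.

    Delete the bounded vertex set S of a maximal family of disjoint k-cycles,
    scale x so that its maximum outside S is x_v = 1, and put A = N(v) \ S.
    Counting the 2-walks from v gives rho^2 <= e(A, V \ A) + 2 e(A) + O(n), and
    e(A) = O(n) because a path on k-1 vertices inside A would close up through v
    to a new k-cycle.  Hence G contains almost all edges of a nearly balanced
    bipartite graph; discarding boundedly many vertices leaves a core (A0, B0) in
    which every vertex is adjacent to almost all of the opposite side.

    Replacing the neighbourhood of any vertex by A0 or by B0 cannot create t
    disjoint k-cycles, so extremality bounds every x_v from below, and each vertex
    outside the set H of hubs (those with many neighbours in both A0 and B0)
    sees almost all of one side and little of the other.  Pairwise disjoint hubs
    and edges inside a side extend to disjoint k-cycles, so there are at most t-1
    of them.  If |H| < t-1, turning one more vertex into a hub gains more than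
    is lost by deleting the few edges inside the sides; so |H| = t-1, the two
    sides are independent, and x > 0 forces G to be the complete multipartite
    graph with parts the two sides and the single hubs.  For such a graph
    the sum of s/(rho+s) over the part sizes s equals 1, and strict concavity of
    s |-> s/(rho+s) shows that the sides differ by at most one vertex. *)

Set Implicit Arguments.
Unset Strict Implicit.
Unset Printing Implicit Defensive.
Import Order.TTheory GRing.Theory Num.Theory.
Local Open Scope ring_scope.

(** * Rayleigh quotients and Perron vectors *)

Lemma bigmax_ge0 (I : Type) (r : seq I) (P : pred I) (F : I -> algC) :
  (forall i, 0 <= F i) -> 0 <= \big[Num.max/0]_(i <- r | P i) F i.
Proof.
move=> F0; elim/big_ind: _ => // x y x0 y0.
by rewrite /Num.max; case: ifP.
Qed.

(** The order on [algC] is partial; nonnegative values are real, hence comparable, which makes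
    [Num.max] a genuine maximum. *)
Lemma le_bigmax_algC (I : eqType) (r : seq I) (P : pred I) (F : I -> algC) i :
  (forall i, 0 <= F i) -> i \in r -> P i ->
  F i <= \big[Num.max/0]_(i <- r | P i) F i.
Proof.
move=> F0; elim: r => // j r IH; rewrite inE big_cons.
have := bigmax_ge0 r P F0; move: IH; set m := \big[_/_]_(_ <- _ | _) _ => IH m0.
have cmp : (F j >=< m)%R by apply: real_comparable; apply: ger0_real.
case/orP=> [/eqP-> ->|ir Pi]; first by rewrite (comparable_le_max _ cmp) lexx.
have Fim := IH ir Pi; case: ifP => _ //.
by rewrite (comparable_le_max _ cmp) Fim orbT.
Qed.

Lemma bigmax_attained (I : eqType) (r : seq I) (P : pred I) (F : I -> algC) i :
  (forall i, 0 <= F i) -> i \in r -> P i ->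
  exists2 j, (j \in r) && P j & \big[Num.max/0]_(i <- r | P i) F i = F j.
Proof.
move=> F0 ir Pi.
(* A maximum equal to the default value 0 is attained at the given [i], since then [F i] is squeezed
   to 0. *)
have [m0|/eqP m0] := eqVneq (\big[Num.max/0]_(i <- r | P i) F i) 0.
  exists i; rewrite ?ir // m0; apply/le_anti; rewrite F0 /=.
  by rewrite -[X in _ <= X]m0 le_bigmax_algC.
have : let m := \big[Num.max/0]_(i <- r | P i) F i in
   m = 0 \/ exists2 j, (j \in r) && P j & m = F j.
  rewrite /= big_seq_cond; elim/big_ind: _ => [|x y Hx Hy|j jr]; first by left.
    by rewrite /Num.max; case: ifP.
  by right; exists j.
by case.
Qed.

Section Rayleigh.
Variables (n : nat) (A : 'M[algC]_n).
Hypothesis Areal : A \is a mxOver Num.real.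
Hypothesis Asym : A \is symmetricmx.
Local Open Scope sesquilinear_scope.

Lemma spectral_radius_ge0 : 0 <= spectral_radius A.
Proof. exact: bigmax_ge0. Qed.

Lemma norm_eigenvalue_le z : eigenvalue A z -> `|z| <= spectral_radius A.
Proof.
by rewrite -mem_eigenvalues => ze; apply: (@le_bigmax_algC _ _ xpredT Num.norm).
Qed.

(** In an orthonormal eigenbasis, where [y] has coordinates [w], the defect is the sum of the
    nonnegative terms [(rho - d 0 i) * |w 0 i| ^ 2]. If it vanishes, every nonzero coordinate
    belongs to the eigenvalue [rho]. *)
Lemma rayleigh (y : 'rV[algC]_n) (rho := spectral_radius A) :
  ((y *m A *m y^t*) 0 0 <= rho * (y *m y^t*) 0 0) /\
  ((y *m A *m y^t*) 0 0 = rho * (y *m y^t*) 0 0 -> y *m A = rho *: y).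
Proof.
have Anorm := symmetric_normalmx Asym Areal.
have Aherm := realsym_hermsym Asym Areal.
have dreal := hermitian_spectral_diag_real Aherm.
have /orthomx_spectralP := Anorm.
have Pun := spectral_unitarymx A.
move: Pun dreal; set P := spectralmx A; set d := spectral_diag A => Pun dreal AE.
have Pu := unitarymx_unit Pun.
have PA : P *m A = diag_mx d *m P by rewrite {1}AE !mulmxA mulmxV // mul1mx.
have deig i : `|d 0 i| <= rho.
  apply: norm_eigenvalue_le; apply/eigenvalueP; exists (row i P).
    rewrite -row_mul PA; apply/rowP => j; rewrite !mxE (bigD1 i) //= big1 => [|k /negbTE ki].
      by rewrite !mxE eqxx mulr1n addr0.
    by rewrite !mxE eq_sym ki mul0r.
  apply/eqP => r0; have : row i (P *m P^t*) = row i 1%:M by rewrite (unitarymxP Pun).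
  rewrite row_mul r0 mul0mx => /rowP/(_ i); rewrite !mxE eqxx => /eqP.
  by rewrite eq_sym oner_eq0.
have [w yE] : exists w, y = w *m P by exists (y *m invmx P); rewrite mulmxKV.
have yy : (y *m y^t*) 0 0 = \sum_i `|w 0 i| ^+ 2.
  rewrite yE trmx_mul map_mxM mulmxA mulmxtVK // mxE.
  by apply: eq_bigr => i _; rewrite !mxE normCK.
have yAy : (y *m A *m y^t*) 0 0 = \sum_i d 0 i * `|w 0 i| ^+ 2.
  rewrite {1}yE -(mulmxA w) PA yE trmx_mul map_mxM !mulmxA mulmxtVK // mxE.
  apply: eq_bigr => i _; rewrite !mxE (bigD1 i) //= big1 ?addr0 => [|k /negbTE ki].
    by rewrite !mxE eqxx mulr1n mulrAC -normCK mulrC.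
  by rewrite !mxE ki mulr0.
have term i : 0 <= (rho - d 0 i) * `|w 0 i| ^+ 2.
  rewrite mulr_ge0 ?exprn_ge0 // subr_ge0 (le_trans _ (deig i)) // real_ler_norm //.
  by have /mxOverP := dreal.
have diff : rho * (y *m y^t*) 0 0 - (y *m A *m y^t*) 0 0 =
    \sum_i (rho - d 0 i) * `|w 0 i| ^+ 2.
  by rewrite yy yAy mulr_sumr -sumrB; apply: eq_bigr => i _; rewrite mulrBl.
split; first by rewrite -subr_ge0 diff sumr_ge0.
move=> eq; move: diff; rewrite eq subrr => /esym/eqP; rewrite psumr_eq0 // => /allP all0.
rewrite {1}yE -mulmxA PA mulmxA yE scalemxAl; congr (_ *m _).
apply/rowP => i; rewrite !mxE (bigD1 i) //= big1 ?addr0 => [|k /negbTE ki]; last first.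
  by rewrite !mxE ki mulr0.
rewrite !mxE eqxx mulr1n; have := all0 i (mem_index_enum _).
rewrite /= mulf_eq0 subr_eq0 expf_eq0 /= normr_eq0 => /orP[/eqP <-|/eqP ->].
  by rewrite mulrC.
by rewrite mul0r mulr0.
Qed.

End Rayleigh.

Lemma sum_enum_val (R : nmodType) (V : finType) (F : V -> R) :
  \sum_(i < #|V|) F (enum_val i) = \sum_v F v.
Proof. by rewrite [RHS](reindex _ (onW_bij _ (enum_val_bij V))). Qed.

(** Ordered pairs are summed, so for a symmetric relation every edge counts twice. *)
Definition quad (R : numDomainType) (V : finType) (e : rel V) (y : V -> R) : R :=
  \sum_u \sum_(v | e u v) y u * y v.

Lemma adjmx_real (V : finType) (G : sgraph V) : adjmx G \is a mxOver Num.real.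
Proof. by apply/mxOverP => i j; rewrite mxE realn. Qed.

Lemma adjmx_sym (V : finType) (G : sgraph V) : adjmx G \is symmetricmx.
Proof.
apply/is_hermitianmxP; rewrite expr0 scale1r; apply/matrixP => i j.
by rewrite !mxE adj_sym.
Qed.

Section Perron.
Local Open Scope sesquilinear_scope.
Variables (V : finType) (G : sgraph V).

Let vec (y : V -> algC) : 'rV[algC]_#|V| := \row_i y (enum_val i).

Let vec_mul y j :
  (vec y *m adjmx G) 0 j = \sum_(u | adj G (enum_val j) u) y u.
Proof.
rewrite mxE [RHS]big_mkcond.
rewrite -(sum_enum_val (fun u => if adj G (enum_val j) u then y u else 0)).
apply: eq_bigr => i _.
by rewrite !mxE adj_sym; case: adj; rewrite ?mulr1 ?mulr0.
Qed.

Let vec_sq y : (vec y *m (vec y)^t*) 0 0 = \sum_v `|y v| ^+ 2.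
Proof.
rewrite mxE -(sum_enum_val (fun v => `|y v| ^+ 2)).
by apply: eq_bigr => i _; rewrite !mxE normCK.
Qed.

Let vec_quad y : (vec y *m adjmx G *m (vec y)^t*) 0 0 =
  \sum_v \sum_(u | adj G v u) y u * (y v)^*.
Proof.
rewrite mxE -(sum_enum_val (fun v => \sum_(u | adj G v u) y u * (y v)^*)).
apply: eq_bigr => j _.
by rewrite vec_mul !mxE mulr_suml.
Qed.

(** Passing to [algR], a totally ordered field, lets the later estimates take place in a real
    field. *)
Lemma quad_le_rho (r : algR) (y : V -> algR) : algRval r = rho G ->
  quad (adj G) y <= r * \sum_v y v ^+ 2.
Proof.
move=> rE; pose z v := algRval (y v).
have zc v : (z v)^* = z v by apply/CrealP/algRvalP.
have [] := rayleigh (adjmx_real G) (adjmx_sym G) (vec z).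
rewrite vec_quad vec_sq -/(rho G) -rE => h _.
suff: algRval (quad (adj G) y) <= algRval (r * \sum_v y v ^+ 2) by [].
have -> : algRval (quad (adj G) y) = \sum_v \sum_(u | adj G v u) z u * (z v)^*.
  rewrite rmorph_sum /=; apply: eq_bigr => v _; rewrite rmorph_sum /=.
  by apply: eq_bigr => u _; rewrite zc mulrC.
rewrite rmorphM rmorph_sum /= (le_trans h) // le_eqVlt; apply/orP; left.
apply/eqP; congr (_ * _).
by apply: eq_bigr => v _; rewrite normCK zc.
Qed.

(** Take an eigenvector for an eigenvalue of largest modulus. By the triangle inequality its
    entrywise moduli [y] satisfy [rho G * y <= A y], so [y] attains the Rayleigh bound and is itself
    an eigenvector for [rho G]. Positivity of the entries comes only later, from extremality. *)
Lemma perron_vector : (0 < #|V|)%N ->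
  exists (r : algR) (x : V -> algR),
    [/\ algRval r = rho G, forall v, 0 <= x v, exists v, x v != 0 &
        forall v, \sum_(u | adj G v u) x u = r * x v].
Proof.
move=> V0; have rge0 := spectral_radius_ge0 (adjmx G).
have [a aeig] := eigenvalue_closed (adjmx G) V0.
have [z /andP[zin _] zE] : exists2 z, (z \in eigenvalues (adjmx G)) && true &
    rho G = `|z|.
  by apply: (@bigmax_attained _ _ xpredT Num.norm a); rewrite ?mem_eigenvalues.
move: zin; rewrite mem_eigenvalues => /eigenvalueP[w wA w0].
pose y v := `|w 0 (enum_rank v)|.
have wE : w = vec (fun v => w 0 (enum_rank v)).
  by apply/rowP => i; rewrite !mxE enum_valK.
have y_le v : rho G * y v <= \sum_(u | adj G v u) y u.
  rewrite zE -normrM.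
  have -> : z * w 0 (enum_rank v) = \sum_(u | adj G v u) w 0 (enum_rank u).
    by have /rowP/(_ (enum_rank v)) := wA; rewrite {1}wE vec_mul enum_rankK mxE.
  exact: ler_norm_sum.
have y_ge0 v : 0 <= y v by apply: normr_ge0.
have yc v : (y v)^* = y v by apply/CrealP/ger0_real.
have [h1 h2] := rayleigh (adjmx_real G) (adjmx_sym G) (vec y).
have {}h2 : vec y *m adjmx G = rho G *: vec y.
  apply: h2; apply/le_anti; rewrite h1 /=.
  rewrite vec_quad vec_sq mulr_sumr; apply: ler_sum => v _.
  by rewrite normCK yc mulrA -mulr_suml ler_wpM2r.
exists (in_algR (ger0_real rge0)), (fun v => in_algR (ger0_real (y_ge0 v))).
split => //.
  have /rV0Pn[i wi] := w0.
  exists (enum_val i); apply/eqP => /(congr1 algRval) /=.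
  by move/eqP; rewrite /y enum_valK normr_eq0 (negbTE wi).
move=> v; apply: val_inj; rewrite /= rmorph_sum /=.
by have /rowP/(_ (enum_rank v)) := h2; rewrite vec_mul !mxE enum_rankK.
Qed.

End Perron.

Local Open Scope nat_scope.

(** * Disjoint cycles and greedy paths *)

Section Packing.
Variables (V : finType) (G : sgraph V).

(** Duplicate-freeness of the concatenation says at once that each closed walk is a cycle and that
    the cycles are pairwise disjoint. *)
Definition cycle_packing (k : nat) (ss : seq (seq V)) : bool :=
  all (fun s => (size s == k) && cycle (adj G) s) ss && uniq (flatten ss).

Lemma size_flatten_const (k : nat) (ss : seq (seq V)) :
  all (fun s => size s == k) ss -> size (flatten ss) = size ss * k.
Proof. by elim: ss => //= s ss IH /andP[/eqP sk /IH]; rewrite size_cat sk mulSn => ->. Qed.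

Lemma nth_flatten_const (k : nat) (ss : seq (seq V)) x0 i j :
  all (fun s => size s == k) ss -> j < k ->
  nth x0 (flatten ss) (i * k + j) = nth x0 (nth [::] ss i) j.
Proof.
elim: ss i => [|s ss IH] i /=; first by rewrite !nth_nil.
move=> /andP[/eqP sk ssk] jk; rewrite nth_cat sk; case: i => [|i] /=.
  by rewrite mul0n jk.
rewrite mulSn -addnA ltnNge leq_addr /= addKn; exact: IH.
Qed.

Lemma cycle_nth (e : rel V) x0 s i : cycle e s -> i < size s ->
  e (nth x0 s i) (nth x0 s (i.+1 %% size s)).
Proof.
case: s => // x p /= /(pathP x0) h; rewrite ltnS => ip.
have := h i; rewrite size_rcons ltnS => /(_ ip).
rewrite -rcons_cons nth_rcons /= ltnS ip nth_rcons.
move: ip; rewrite leq_eqVlt => /orP[/eqP->|ip]; first by rewrite ltnn eqxx modnn.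
by rewrite ip modn_small.
Qed.

(** Vertex [j] of cycle [i] sits at position [i * k + j] of the concatenation; division with
    remainder gives injectivity. The cases [t = 0] and [k = 0] are apart because they provide no
    default vertex. *)
Lemma packing_contains (k t : nat) (ss : seq (seq V)) :
  t <= size ss -> cycle_packing k ss -> contains (copies t (cycle_graph k)) G.
Proof.
move=> tss /andP[ssk ssu].
have ssk1 : all (fun s => size s == k) ss by apply: sub_all ssk => s /andP[].
have [t0|] := posnP t.
  have h (p : 'I_t * 'I_k) : False by case: p => -[i]; rewrite t0.
  apply/existsP; exists [ffun p => match h p with end].
  apply/andP; split; first by apply/injectiveP => p; case: (h p).
  by apply/forallP => p; case: (h p).
move=> t0; have [k0|k0] := posnP k.
  have h (p : 'I_t * 'I_k) : False by case: p => _ -[i]; rewrite k0.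
  apply/existsP; exists [ffun p => match h p with end].
  apply/andP; split; first by apply/injectiveP => p; case: (h p).
  by apply/forallP => p; case: (h p).
have [x0 _] : exists x0 : V, true.
  case: ss tss ssk {ssu ssk1} => [|s ss]; first by rewrite leqNgt t0.
  by move=> _ /andP[/andP[/eqP sk _] _]; case: s sk k0 => [<-|x0] //; exists x0.
pose f := [ffun p : 'I_t * 'I_k => nth x0 (flatten ss) (p.1 * k + p.2)].
have fE i j : f (i, j) = nth x0 (nth [::] ss i) j by rewrite ffunE nth_flatten_const.
apply/existsP; exists f; apply/andP; split.
  apply/injectiveP => -[i j] [i' j']; rewrite !ffunE /= => /eqP.
  have lt (a : 'I_t) (b : 'I_k) : a * k + b < size (flatten ss).
    rewrite (size_flatten_const ssk1) (@leq_trans (a.+1 * k)) //.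
      by rewrite mulSnr ltn_add2l.
    by rewrite leq_mul2r (leq_trans _ tss) ?orbT.
  rewrite nth_uniq // => /eqP eq; congr pair; apply: val_inj => /=.
    have := congr1 (divn^~ k) eq; rewrite !divnMDl // !divn_small // !addn0 //.
  by have := congr1 (modn^~ k) eq; rewrite !modnMDl !modn_small.
apply/forallP => -[i j]; apply/forallP => -[i' j']; apply/implyP.
rewrite adj_of_rel /= => /andP[_].
have step (a : 'I_t) (b : 'I_k) : adj G (f (a, b)) (f (a, ordS b)).
  rewrite !fE /=.
  have a_lt : a < size ss by apply: leq_trans tss.
  have /andP[/eqP sk cs] := allP ssk _ (mem_nth [::] a_lt).
  by rewrite -[X in _ %% X]sk; apply: cycle_nth; rewrite ?sk.
have sym := adj_sym G.
rewrite !adj_of_rel => /orP[] /andP[/eqP-> /andP[_ /orP[]/eqP->]];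
  by rewrite ?step // sym step.
Qed.

Lemma free_packing (k t : nat) (ss : seq (seq V)) :
  Defs.free (copies t (cycle_graph k)) G -> cycle_packing k ss -> size ss < t.
Proof.
move=> Gfree pk; rewrite ltnNge; apply: contra Gfree => tss.
exact: packing_contains pk.
Qed.

End Packing.

Section Greedy.
Variable V : finType.
Implicit Types (A B Y : {set V}) (e : rel V).

Lemma exists_outside A B : #|B| < #|A| -> exists2 x, x \in A & x \notin B.
Proof.
move=> BA; apply/subsetPn; apply: contraL BA => /subset_leq_card.
by rewrite -leqNgt.
Qed.

Lemma card_set_seq (s : seq V) : #|[set x in s]| <= size s.
Proof. by rewrite cardsE card_size. Qed.

Lemma greedy_path e (X : nat -> {set V}) Y m :
  (forall i x, i < m -> x \in X i ->
    #|Y| + m < #|[set y in X i.+1 | e x y]|) ->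
  forall x, x \in X 0 -> x \notin Y ->
  exists p, [/\ size p = m, path e x p, uniq (x :: p),
    forall y, y \in x :: p -> y \notin Y
    & forall i, i <= m -> nth x (x :: p) i \in X i].
Proof.
move=> deg x x0 xY.
suff H j : j <= m -> exists p, [/\ size p = j, path e x p, uniq (x :: p),
    forall y, y \in x :: p -> y \notin Y
    & forall i, i <= j -> nth x (x :: p) i \in X i] by exact: H.
elim: j => [_|j IH jm].
  exists [::]; split => // [y|[]//]; by rewrite inE => /eqP->.
have [p [sp pp up Yp Xp]] := IH (ltnW jm).
have [] := @exists_outside [set y in X j.+1 | e (nth x (x :: p) j) y]
  (Y :|: [set z in x :: p]).
  apply: leq_ltn_trans (deg j _ jm (Xp j (leqnn j))).
  apply: (leq_trans (leq_card_setU _ _)); rewrite leq_add2l.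
  by apply: (leq_trans (card_set_seq _)); rewrite /= sp.
move=> y; rewrite !inE negb_or => /andP[yX ey] /andP[yY /norP[yx yp]].
have lastE : last x p = nth x (x :: p) j by rewrite (last_nth x) sp.
exists (rcons p y); split.
- by rewrite size_rcons sp.
- by rewrite rcons_path pp lastE.
- by rewrite -rcons_cons rcons_uniq up inE negb_or yx yp.
- by move=> z; rewrite -rcons_cons mem_rcons inE => /orP[/eqP->|/Yp].
- move=> i; rewrite leq_eqVlt -rcons_cons nth_rcons /= sp => /orP[/eqP->|ij].
    by rewrite ltnn eqxx.
  by rewrite ij Xp.
Qed.

(** If all degrees inside [A] exceed [m], a path with [m] edges is found greedily. Otherwise a
    vertex of degree at most [m] is deleted, which lowers the degree sum by at most [2 * m]. *)
Lemma path_free_edges e m A : symmetric e ->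
  (forall x p, size p = m -> path e x p -> uniq (x :: p) ->
     ~ {subset x :: p <= A}) ->
  \sum_(u in A) #|[set v in A | e u v]| <= 2 * m * #|A|.
Proof.
move=> esym; have [N] := ubnP #|A|; elim: N A => // N IH A.
rewrite ltnS => AN nopath.
have [/existsP[u /andP[uA du]]|/existsPn hd] :=
    boolP [exists u, (u \in A) && (#|[set v in A | e u v]| <= m)].
  have cA : #|A| = #|A :\ u|.+1 by rewrite (cardsD1 u) uA.
  have := IH (A :\ u); rewrite -ltnS -cA ltnS => /(_ AN) {}IH.
  rewrite (big_setD1 u) //= cA mulnS.
  have : \sum_(w in A :\ u) #|[set v in A :\ u | e w v]| <= 2 * m * #|A :\ u|.
    apply: IH => x p sp pp up sub; apply: (nopath x p sp pp up) => z /sub.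
    by rewrite !inE => /andP[].
  have : \sum_(w in A :\ u) #|[set v in A | e w v]| <=
      \sum_(w in A :\ u) #|[set v in A :\ u | e w v]| + #|[set v in A | e u v]|.
    have -> : #|[set v in A | e u v]| = \sum_(w | (w \in A) && e u w) 1.
      by rewrite -sum1_card; apply: eq_bigl => w; rewrite inE.
    rewrite (@leq_trans (\sum_(w in A :\ u) (#|[set v in A :\ u | e w v]| + e u w))) //.
      apply: leq_sum => w _; rewrite (cardsD1 u) addnC leq_add //.
        by apply: subset_leq_card; apply/subsetP => z; rewrite !inE => /and3P[-> -> ->].
      by rewrite !inE uA esym.
    rewrite big_split /= leq_add2l [X in _ <= X]big_mkcond /=.
    rewrite [X in X <= _]big_mkcond /= ; apply: leq_sum => w _; rewrite !inE.
    by case: (w == u); case: (w \in A) => //=; case: (e u w).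
  lia.
have [->|[x xA]] := set_0Vmem A; first by rewrite big_set0.
have [i y _ yA||p [sp pp up _ Ap]] := @greedy_path e (fun=> A) set0 m _ x xA.
- rewrite cards0; have := hd y; rewrite yA /= -ltnNge add0n; exact.
- by rewrite inE.
case: (nopath x p sp pp up) => z /(nthP x)[i]; rewrite /= ltnS sp => im <-.
exact: Ap.
Qed.

End Greedy.

(** * Two constructions of tC_k-free graphs *)

Lemma adj_copies_cycle (t k : nat) (i : 'I_t) (j : 'I_k) : 1 < k ->
  adj (copies t (cycle_graph k)) (i, j) (i, ordS j).
Proof.
move=> k1; have jS : j != ordS j.
  apply/eqP => /(congr1 val) /=; move: (ltn_ord j); rewrite leq_eqVlt.
  case/orP=> [/eqP e|jk]; last by rewrite modn_small // => /n_Sn.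
  by rewrite e modnn => j0; move: e k1; rewrite j0 => <-.
by rewrite !adj_of_rel /= !eqxx jS /= xpair_eqE negb_and jS orbT.
Qed.

(** The colour of vertex [j] would follow the parity of [j], but the closing step leads from the
    even index [2 * l] back to 0. *)
Lemma odd_cycle_not_bicolored (V : finType) (c : V -> bool) (l : nat)
    (f : 'I_(2 * l + 1) -> V) :
  ~ (forall j, c (f (ordS j)) = ~~ c (f j)).
Proof.
move=> h.
have k0 : 0 < 2 * l + 1 by rewrite addn1.
have cE j (jk : j < 2 * l + 1) : c (f (Ordinal jk)) = c (f (Ordinal k0)) (+) odd j.
  elim: j jk => [|j IH] jk.
    by rewrite addbF; congr (c (f _)); apply: val_inj.
  have jk' := ltnW jk; have := h (Ordinal jk'); rewrite IH.
  have -> : ordS (Ordinal jk') = Ordinal jk by apply: val_inj; rewrite /= modn_small.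
  by move=> -> /=; rewrite -addbN.
have lk : 2 * l < 2 * l + 1 by rewrite addn1.
have := h (Ordinal lk); rewrite cE.
have -> : ordS (Ordinal lk) = Ordinal k0.
  by apply: val_inj; rewrite /= -[X in X %% _]addn1 modnn.
have -> : odd (2 * l) = false by rewrite mul2n odd_double.
by rewrite addbF; case: (c _).
Qed.

(** Every odd cycle meets [R], because [c] is a proper 2-colouring outside it; [t] disjoint cycles
    would need [t] vertices of [R]. *)
Lemma bicolored_outside_free (V : finType) (G : sgraph V) (c : V -> bool)
    (R : {set V}) (t l : nat) : 0 < l -> #|R| < t ->
  (forall u v, u \notin R -> v \notin R -> adj G u v -> c u != c v) ->
  Defs.free (copies t (cycle_graph (2 * l + 1))) G.
Proof.
move=> l0 Rt col; apply/negP => /existsP[f /andP[/injectiveP finj]].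
move=> /forallP fadj.
have hit (i : 'I_t) : exists j, f (i, j) \in R.
  apply/existsP; apply: contraT => /existsPn nR; exfalso.
  apply: (@odd_cycle_not_bicolored V c l (fun j => f (i, j))) => j /=.
  have := fadj (i, j) => /forallP/(_ (i, ordS j)).
  rewrite adj_copies_cycle /=; last by rewrite addn1 ltnS muln_gt0.
  by move/(col _ _ (nR j) (nR _)); case: (c _); case: (c _).
pose g (i : 'I_t) := f (i, xchoose (hit i)).
have ginj : injective g by move=> i i' /finj [].
have : #|[set g i | i in 'I_t]| <= #|R|.
  apply: subset_leq_card; apply/subsetP => _ /imsetP[i _ ->].
  exact: (xchooseP (hit i)).
by rewrite card_imset // card_ord leqNgt Rt.
Qed.

(** The neighbourhood of [v] becomes [C :\ v]. The test [w != v] discards the old edges at [v],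
    which the symmetrisation in [sgraph_of_rel] would otherwise restore. *)
Definition rewire (V : finType) (G : sgraph V) (v : V) (C : {set V}) : sgraph V :=
  sgraph_of_rel (fun u w => if u == v then w \in C else (w != v) && adj G u w).

Lemma adj_rewire_at (V : finType) (G : sgraph V) v (C : {set V}) w :
  adj (rewire G v C) v w = (w \in C :\ v).
Proof. by rewrite adj_of_rel !inE eqxx eq_sym; case: (w == v) => //=; rewrite orbF. Qed.

Lemma adj_rewire_off (V : finType) (G : sgraph V) v (C : {set V}) u w :
  u != v -> w != v -> adj (rewire G v C) u w = adj G u w.
Proof.
move=> uv wv; rewrite adj_of_rel (negbTE uv) (negbTE wv) /=.
rewrite (adj_sym G w) orbb andb_idl // => a; apply/eqP => uw.
by move: a; rewrite uw adj_irrefl.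
Qed.

(* A copy of F through the rewired vertex v can be rerouted through a common
   neighbour of the images of the other vertices of F lying in C. *)
Lemma rewire_free (U V : finType) (F : sgraph U) (G : sgraph V) v (C : {set V}) :
  (forall X Y : {set V}, X \subset C -> #|X| <= #|U| -> #|Y| <= #|U| ->
     exists2 a, a \notin Y & forall x, x \in X -> adj G a x) ->
  Defs.free F G -> Defs.free F (rewire G v C).
Proof.
move=> common; apply: contra => /existsP[f /andP[/injectiveP finj fadj]].
have {}fadj p q : adj F p q -> adj (rewire G v C) (f p) (f q).
  by have /forallP/(_ p)/forallP/(_ q)/implyP := fadj.
have [] := common ([set f q | q in U] :&: C) [set f q | q in U].
- exact: subsetIr.
- by apply: leq_trans (subset_leq_card (subsetIl _ _)) _; exact: leq_imset_card.
- exact: leq_imset_card.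
move=> a aN aC; pose g := [ffun q => if f q == v then a else f q].
have fNa q : f q != a.
  by apply: contraNneq aN => <-; apply: imset_f.
apply/existsP; exists g; apply/andP; split.
  apply/injectiveP => p q; rewrite !ffunE.
  case: eqP => [fp|_]; case: eqP => [fq|_].
  - by move=> _; apply: finj; rewrite fp.
  - by move=> e; have := fNa q; rewrite e eqxx.
  - by move=> e; have := fNa p; rewrite e eqxx.
  - exact: finj.
apply/forallP => p; apply/forallP => q; apply/implyP => pq.
have := fadj _ _ pq; rewrite !ffunE; case: eqP => [fp|/eqP fp]; case: eqP => [fq|/eqP fq].
- by rewrite fp fq adj_irrefl.
- by rewrite fp adj_rewire_at !inE => /andP[_ qC]; rewrite aC // inE qC imset_f.
- rewrite fq adj_sym adj_rewire_at !inE => /andP[_ pC].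
  by rewrite adj_sym aC // inE pC imset_f.
- by rewrite adj_rewire_off.
Qed.

Local Open Scope ring_scope.

(** * Isolating one vertex in the quadratic form *)

Section Quad.
Variables (R : realFieldType) (V : finType).
Implicit Types (e : rel V) (y : V -> R).

Lemma quad_split e y v : symmetric e -> irreflexive e ->
  quad e y = 2 * y v * (\sum_(w | e v w) y w) +
    \sum_(u | u != v) \sum_(w | (w != v) && e u w) y u * y w.
Proof.
move=> esym eirr; rewrite /quad (bigD1 v) //= -mulr_sumr.
have -> : \sum_(u | u != v) \sum_(w | e u w) y u * y w =
    \sum_(u | u != v) (if e v u then y v * y u else 0) +
    \sum_(u | u != v) \sum_(w | (w != v) && e u w) y u * y w.
  rewrite -big_split /=; apply: eq_bigr => u _.
  rewrite [LHS](bigID (fun w => w == v)) /=; congr (_ + _).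
    case: ifP => evu; last first.
      by rewrite big1 // => w /andP[euw /eqP wv]; rewrite wv esym evu in euw.
    rewrite (big_pred1 v) 1?mulrC // => w; rewrite /= andbC.
    by case: eqP => // ->; rewrite esym.
  by apply: eq_bigl => w; rewrite andbC.
have -> : \sum_(u | u != v) (if e v u then y v * y u else 0) =
    y v * \sum_(w | e v w) y w.
  rewrite mulr_sumr [RHS]big_mkcond [RHS](bigD1 v) //= eirr add0r.
  by [].
by rewrite addrA; congr (_ + _); ring.
Qed.

Lemma sum_sq_split y v : \sum_u y u ^+ 2 = y v ^+ 2 + \sum_(u | u != v) y u ^+ 2.
Proof. by rewrite (bigD1 v). Qed.

End Quad.

Local Open Scope ring_scope.

(** * Consequences of spectral extremality *)

Section PerronPair.
Variables (R : realFieldType) (V : finType).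
Implicit Types (G : sgraph V) (x : V -> R) (r : R).

Definition perron_pair G r x :=
  [/\ forall v, 0 <= x v, exists v, x v != 0 &
      forall v, \sum_(u | adj G v u) x u = r * x v].

(** Expresses through Rayleigh quotients that [r] bounds the spectral radius of every [F]-free graph
    on [V]; this form makes sense over any real field. *)
Definition spectral_bound (U : finType) (F : sgraph U) r :=
  forall G (y : V -> R), Defs.free F G -> quad (adj G) y <= r * \sum_v y v ^+ 2.

Lemma quad_perron G r x : perron_pair G r x -> quad (adj G) x = r * \sum_v x v ^+ 2.
Proof.
case=> _ _ eig; rewrite /quad mulr_sumr; apply: eq_bigr => u _.
by rewrite -mulr_sumr eig; ring.
Qed.

Lemma exists_subset_card m : (m <= #|V|)%N -> exists P : {set V}, #|P| = m.
Proof.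
move=> mV; exists [set v in take m (enum V)].
rewrite cardsE; have /card_uniqP -> : uniq (take m (enum V)).
  by rewrite take_uniq // enum_uniq.
by rewrite size_take -cardE; case: ltngtP mV.
Qed.

(** The all-ones vector on a balanced complete bipartite graph gives [r * n >= 2 * floor(n^2 / 4) >=
    (n^2 - 1) / 2]. *)
Lemma half_le_spectral_bound t l r : (0 < t)%N -> (0 < l)%N -> (0 < #|V|)%N ->
  spectral_bound (copies t (cycle_graph (2 * l + 1))) r -> #|V|%:R <= 2 * r + 1.
Proof.
move=> t0 l0 V0 bound.
have [P cP] : exists P : {set V}, #|P| = #|V|./2.
  by apply: exists_subset_card; lia.
pose G := sgraph_of_rel (fun u v => (u \in P) != (v \in P)).
have adjE u v : adj G u v = ((u \in P) != (v \in P)).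
  by rewrite adj_of_rel (eq_sym (v \in P)) orbb andb_idl //; apply: contraNneq => ->.
have Gfree : Defs.free (copies t (cycle_graph (2 * l + 1))) G.
  apply: (@bicolored_outside_free V G (fun u => u \in P) set0) => //.
    by rewrite cards0.
  by move=> u v _ _; rewrite adjE.
have := bound G (fun=> 1) Gfree.
have -> : quad (adj G) (fun=> 1 : R) = (2 * (#|P| * #|~: P|))%:R.
  rewrite /quad (bigID (mem P)) /=.
  under eq_bigr => u uP.
    under eq_bigl => v do rewrite adjE uP.
    rewrite mulr1 sumr_const; over.
  under [X in _ + X]eq_bigr => u uP.
    under eq_bigl => v do rewrite adjE (negbTE uP).
    rewrite mulr1 sumr_const; over.
  rewrite !sumr_const -!mulrnA -natrD; congr _%:R.
  have -> : #|fun i : V => true != (i \in P)| = #|~: P|.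
    by apply: eq_card => v; rewrite [LHS]unfold_in ?inE; case: (v \in P).
  have -> : #|fun i : V => false != (i \in P)| = #|P|.
    by apply: eq_card => v; rewrite [LHS]unfold_in ?inE; case: (v \in P).
  by rewrite mulnC mul2n addnn.
rewrite (eq_bigr (fun=> 1)) => [|v _]; last by rewrite expr1n.
rewrite sumr_const; set n := #|V|.
have cPC : (#|P| + #|~: P|)%N = n by rewrite cardsC.
have : (n ^ 2 <= 4 * (#|P| * #|~: P|) + 1)%N.
  by move: cPC; rewrite cP /= -/n; move: (#|~: P|) => q; nia.
have n0 : (0 : R) < n%:R by rewrite ltr0n.
have n1 : (1 : R) <= n%:R by rewrite ler1n.
rewrite -(ler_nat R) !natrD natrX !natrM; move: (_%:R * #|_|%:R : R) => a.
move: n0 n1; move: (n%:R : R) => m m0 m1 h1 h2.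
rewrite -(ler_pM2r m0); nra.
Qed.

(** Let the global maximum be at [z] in [Q] and the maximum off [Q] at [v]. The eigenvalue equation
    at [z] gives [(r - q) * x z <= n * x v <= (2 * r + 1) * x v], and [3 * q + 1 <= r] says exactly
    that [2 * r + 1 <= 3 * (r - q)]; hence the bound 3. *)
Lemma perron_normalize G r x (Q : {set V}) (q : nat) :
  perron_pair G r x -> (#|Q| <= q)%N -> #|V|%:R <= 2 * r + 1 -> 3 * q%:R + 1 <= r ->
  exists x' v, [/\ perron_pair G r x', v \notin Q, x' v = 1,
    forall u, u \notin Q -> x' u <= 1 & forall u, x' u <= 3].
Proof.
move=> [x0 [v0 xv0] eig] Qq nr qr.
have q0 : (0 : R) <= q%:R by rewrite ler0n.
suff [v [vQ xv off all3]] : exists v, [/\ v \notin Q, 0 < x v,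
    forall u, u \notin Q -> x u <= x v & forall u, x u <= 3 * x v].
  have xvN : x v != 0 by rewrite gt_eqF.
  exists (fun u => x u / x v), v; split => //.
  - split=> [u||u]; first by rewrite divr_ge0.
      by exists v; rewrite divff // oner_neq0.
    by rewrite -mulr_suml eig mulrA.
  - by rewrite divff.
  - by move=> u uQ; rewrite ler_pdivrMr // mul1r off.
  - by move=> u; rewrite ler_pdivrMr.
have [z [zmax zpos]] : exists z, (forall u, x u <= x z) /\ 0 < x z.
  case: (@arg_maxP _ _ _ v0 xpredT x isT) => z _ zm; exists z.
  have zm' u : x u <= x z by exact: zm.
  split=> //; apply: lt_le_trans (zm' v0); by rewrite lt_def xv0 x0.
have [zQ|zQ] := boolP (z \in Q); last first.
  exists z; split=> // u; apply: (le_trans (zmax u)).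
  by rewrite ler_peMl ?x0 // ler1n.
have split_sum : r * x z <= q%:R * x z + \sum_(u | u \notin Q) x u.
  rewrite -eig big_mkcond (bigID (mem Q)) /= lerD //.
    apply: (@le_trans _ _ (\sum_(u in Q) x z)).
      by apply: ler_sum => u _; case: ifP.
    by rewrite sumr_const -[x z *+ _]mulr_natl ler_wpM2r ?x0 // ler_nat.
  by apply: ler_sum => u _; case: ifP.
have [w wQ] : exists w, w \notin Q.
  apply/existsP; apply: contraT => /existsPn h; exfalso.
  move: split_sum; rewrite big1 => [|u uQ]; last by have := h u; rewrite uQ.
  nra.
case: (@arg_maxP _ _ _ w (fun u => u \notin Q) x wQ) => v vQ vmax.
have key : x z * (r - q%:R) <= #|V|%:R * x v.
  have : \sum_(u | u \notin Q) x u <= #|V|%:R * x v.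
    apply: (@le_trans _ _ (\sum_(u : V) x v)); last by rewrite sumr_const -[x v *+ _]mulr_natl.
    by rewrite big_mkcond; apply: ler_sum => u _; case: ifP => // uQ; apply: vmax.
  nra.
have xv : x z <= 3 * x v by have := x0 v; nra.
exists v; split=> //; first lra.
by move=> u; apply: le_trans xv.
Qed.

(** Only the terms at [v] differ between the two forms. With the entry at [v] reoptimised they
    contribute [W ^ 2 / r] after rewiring and [r * x v ^ 2] before, and the spectral bound forbids a
    gain. *)
Lemma rewire_weight (U : finType) (F : sgraph U) G r x v (C : {set V}) :
  perron_pair G r x -> spectral_bound F r -> 0 < r ->
  Defs.free F (rewire G v C) -> \sum_(w in C :\ v) x w <= r * x v.
Proof.
move=> px bound r0 Gfree; have [x0 _ eig] := px.
set W := \sum_(w in _) _.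
(* The value W / r maximises 2 W s - r s ^ 2, the part of the form involving y v = s. *)
pose y u := if u == v then W / r else x u.
have yv : y v = W / r by rewrite /y eqxx.
have yE u : u != v -> y u = x u by rewrite /y => /negbTE->.
have := bound _ y Gfree.
rewrite (quad_split y v (adj_sym _) (adj_irrefl _)) (sum_sq_split y v) yv.
have -> : \sum_(w | adj (rewire G v C) v w) y w = W.
  rewrite (eq_bigl (mem (C :\ v))) => [|w]; last by rewrite adj_rewire_at.
  by apply: eq_bigr => w; rewrite !inE => /andP[/yE].
have := quad_perron px.
rewrite (quad_split x v (adj_sym _) (adj_irrefl _)) (sum_sq_split x v) eig.
have -> : \sum_(u | u != v) \sum_(w | (w != v) && adj (rewire G v C) u w) y u * y w =
   \sum_(u | u != v) \sum_(w | (w != v) && adj G u w) x u * x w.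
  apply: eq_bigr => u uv.
  rewrite (eq_bigl (fun w => (w != v) && adj G u w)) => [|w].
    by apply: eq_bigr => w /andP[wv _]; rewrite !yE.
  by have [//|wv] := eqVneq w v; rewrite adj_rewire_off.
have -> : \sum_(u | u != v) y u ^+ 2 = \sum_(u | u != v) x u ^+ 2.
  by apply: eq_bigr => u uv; rewrite yE.
move: (\sum_(u | u != v) _) (\sum_(u | u != v) _) => S T e1 e2.
have W0 : 0 <= W by apply: sumr_ge0.
have : W ^+ 2 <= (r * x v) ^+ 2.
  have e3 : r * (W / r) ^+ 2 = W ^+ 2 / r by field; rewrite gt_eqF.
  have e4 : 2 * (W / r) * W = 2 * (W ^+ 2 / r) by field; rewrite gt_eqF.
  have : W ^+ 2 / r <= r * x v ^+ 2.
    by move: e2; rewrite mulrDr e3 e4; nra.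
  by rewrite ler_pdivrMr //; nra.
by rewrite ler_pXn2r // ?nnegrE // mulr_ge0 // ltW.
Qed.

End PerronPair.

(** * Approximation by a bipartite graph *)

Section Structure.
Variables (V : finType) (G : sgraph V).

Definition nbrs (B : {set V}) (u : V) : {set V} := [set v in B | adj G u v].

(** A packing in a free graph has fewer than [t] cycles, so adding disjoint cycles one by one must
    stop. *)
Lemma maximal_packing (k t : nat) :
  Defs.free (copies t (cycle_graph k)) G ->
  exists2 ss, cycle_packing G k ss &
    forall s, size s = k -> cycle (adj G) s -> uniq s -> has (mem (flatten ss)) s.
Proof.
move=> Gfree.
suff H d ss : (t - size ss <= d)%N -> cycle_packing G k ss ->
    exists2 ss, cycle_packing G k ss &
    forall s, size s = k -> cycle (adj G) s -> uniq s -> has (mem (flatten ss)) s.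
  by apply: (H t [::]) => //; rewrite leq_subr.
elim: d ss => [|d IH] ss dss pk; have st := free_packing Gfree pk; first lia.
have [/existsP[s /and3P[cs us dis]]|/existsPn h] := boolP [exists s : k.-tuple V,
    [&& cycle (adj G) s, uniq s & ~~ has (mem (flatten ss)) s]].
  apply: (IH (tval s :: ss)); first by move: st dss => /=; lia.
  move: pk => /andP[pk uk]; rewrite /cycle_packing /= size_tuple eqxx cs pk.
  rewrite cat_uniq us uk andbT has_sym (eq_has (a2 := mem (flatten ss))) ?dis //.
exists ss => // s sk cs us; move/eqP in sk.
by have := h (Tuple sk); rewrite /= cs us /= negbK.
Qed.

Lemma bipartite_approximation (R : realFieldType) (r : R) (x : V -> R) (t l : nat)
    (q := (t * (2 * l + 1))%N) :
  (0 < t)%N -> (0 < l)%N -> (0 < #|V|)%N ->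
  Defs.free (copies t (cycle_graph (2 * l + 1))) G ->
  perron_pair G r x -> #|V|%:R <= 2 * r + 1 -> 3 * q%:R + 1 <= r ->
  exists A B : {set V}, [/\ [disjoint A & B], (#|~: (A :|: B)| <= q)%N &
    (#|V| ^ 2 <= 4 * (\sum_(u in A) #|nbrs B u|) + 40 * q * #|V|)%N].
Proof.
move=> t0 l0 V0 Gfree px nr qr.
have [ss pk maxpk] := maximal_packing Gfree.
pose S := [set y in flatten ss].
have Sq : (#|S| <= q)%N.
  apply: (leq_trans (card_set_seq _)).
  have /andP[ssk _] := pk.
  rewrite (@size_flatten_const _ (2 * l + 1)); last by apply: sub_all ssk => s /andP[].
  by rewrite leq_mul2r (ltnW (free_packing Gfree pk)) orbT.
have [y [v [[y0 _ eig] vS yv yoff y3]]] := perron_normalize px Sq nr qr.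
pose A := [set u | adj G v u && (u \notin S)].
pose B := ~: (A :|: S).
have AS u : u \in A -> u \notin S by rewrite inE => /andP[].
exists A, B; split.
- rewrite -setI_eq0; apply/eqP/setP => u.
  by rewrite !inE; case: (adj G v u); case: (u \in flatten ss).
- apply: leq_trans Sq; apply: subset_leq_card; apply/subsetP => u.
  by rewrite !inE; case: (adj G v u); case: (u \in flatten ss).
(* A path with [2 * l - 1] edges inside [A] would close up through [v] to a cycle avoiding [S],
   against maximality. *)
have AA : (\sum_(u in A) #|nbrs A u| <= 2 * (2 * l - 1) * #|A|)%N.
  apply: path_free_edges (adj_sym G) _ => z p sp pp up sub.
  have : has (mem (flatten ss)) (v :: z :: p).
    have zA : adj G v z by have := sub z (mem_head _ _); rewrite inE => /andP[].
    have lA : adj G (last z p) v.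
      by have := sub _ (mem_last z p); rewrite inE adj_sym => /andP[].
    apply: maxpk; first by rewrite /= sp; lia.
      by rewrite /= rcons_path zA pp lA.
    rewrite cons_uniq up andbT; apply/negP => /sub.
    by rewrite inE adj_irrefl.
  case/hasP => w; rewrite inE => /orP[/eqP->|wp] /= wss.
    by move: vS; rewrite inE wss.
  by have := AS _ (sub _ wp); rewrite inE wss.
have An : (#|A| <= #|V|)%N by exact: max_card.
set E := (\sum_(u in A) #|nbrs B u|)%N.
(* The 2-walks from [v] are sorted by type: second vertex in [S] (at most [3 * q * n]), last vertex
   in [S] (again [3 * q * n]), both in [A] (at most [4 * l * n]), and from [A] to [B]. *)
have rr : r ^+ 2 <= 6 * q%:R * #|V|%:R + 4 * l%:R * #|V|%:R + E%:R.
  have -> : r ^+ 2 = \sum_(u | adj G v u) \sum_(w | adj G u w) y w.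
    rewrite -[LHS]mulr1 -yv expr2 -mulrA -eig mulr_sumr.
    by apply: eq_bigr => u _; rewrite eig.
  have inS u : \sum_(w | adj G u w) y w <= 3 * #|V|%:R.
    apply: (@le_trans _ _ (\sum_(w : V) 3)); last by rewrite sumr_const -[3 *+ _]mulr_natr.
    by rewrite big_mkcond; apply: ler_sum => w _; case: ifP.
  have inA u : u \in A ->
      \sum_(w | adj G u w) y w <= 3 * q%:R + (#|nbrs A u|)%:R + (#|nbrs B u|)%:R.
    move=> uA; have cE (C : {set V}) : (#|nbrs C u|)%:R = \sum_(w in C) (adj G u w)%:R :> R.
      rewrite -sum1_card natr_sum big_mkcond [RHS]big_mkcond /=.
      by apply: eq_bigr => w _; rewrite !inE; case: (w \in C); case: (adj G u w).
    rewrite !cE.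
    have -> : \sum_(w in B) (adj G u w)%:R =
        \sum_(w | (w \notin S) && (w \notin A)) (adj G u w)%:R :> R.
      by apply: eq_bigl => w; rewrite !inE negb_or andbC.
    rewrite big_mkcond (bigID (mem S)) /= -addrA lerD //.
      apply: (@le_trans _ _ (\sum_(w in S) 3)); first by apply: ler_sum => w _; case: ifP.
      rewrite sumr_const -[3 *+ _]mulr_natr ler_wpM2l // ler_nat //.
    rewrite [X in X <= _](bigID (mem A)) /= lerD //.
      rewrite [X in X <= _](eq_bigl (mem A)).
        by apply: ler_sum => w wA; case: ifP => _ //; rewrite yoff // AS.
      by move=> w /=; rewrite andb_idl //; exact: AS.
    by apply: ler_sum => w /andP[wS _]; case: ifP => _ //; rewrite yoff.
  rewrite (bigID (mem S)) /=.
  have le1 : \sum_(u | adj G v u && (u \in S)) \sum_(w | adj G u w) y w <= 3 * #|V|%:R * q%:R.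
    apply: (@le_trans _ _ (\sum_(u in S) (3 * #|V|%:R))).
      rewrite big_mkcond [X in _ <= X]big_mkcond; apply: ler_sum => u _.
      by case: (u \in S); case: (adj G v u) => //=; rewrite mulr_ge0.
    rewrite sumr_const -[_ *+ _]mulr_natr ler_wpM2l ?mulr_ge0 // ler_nat //.
  have le2 : \sum_(u | adj G v u && (u \notin S)) \sum_(w | adj G u w) y w <=
      3 * q%:R * #|V|%:R + 4 * l%:R * #|V|%:R + E%:R.
    rewrite (eq_bigl (mem A)) => [|u]; last by rewrite !inE.
    apply: (le_trans (ler_sum _ inA)); rewrite !big_split /=.
    rewrite /E natr_sum lerD // lerD //.
      by rewrite sumr_const -[_ *+ _]mulr_natr ler_wpM2l ?mulr_ge0 // ler_nat.
    rewrite -natr_sum -!natrM ler_nat (leq_trans AA) //.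
    by rewrite leq_mul //; lia.
  lra.
rewrite -(ler_nat R) natrX natrD (natrM _ (40 * q)) (natrM _ 4) (natrM _ 40).
have q2 : (8 * l + 1 <= 4 * q)%N by rewrite /q; nia.
have {}q2 : 8 * l%:R + 1 <= 4 * q%:R :> R by rewrite -!natrM natr1 ler_nat -addn1.
have n1 : 1 <= #|V|%:R :> R by rewrite ler1n.
have a0 : 0 <= q%:R :> R by [].
move: rr nr qr q2 n1 a0; move: (#|V|%:R : R) (E%:R : R) (q%:R : R) (l%:R : R) => n e a b.
clear => rr nr qr q2 n1 a0.
(* The remaining terms [16 * b * n + 2 * n] are absorbed into [8 * a * n]; together with
   [24 * a * n] this stays below [40 * a * n]. *)
have n2 : n ^+ 2 <= 4 * r ^+ 2 + 2 * n by nra.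
have : (8 * b + 1) * n <= (4 * a) * n by rewrite ler_wpM2r //; lra.
have : 0 <= a * n by rewrite mulr_ge0 //; lra.
lra.
Qed.

End Structure.

Local Open Scope nat_scope.

(** * The dense core and extension of seeds to cycles *)

Lemma markov_card (V : finType) (A : {set V}) (f : V -> nat) (n D m : nat) :
  \sum_(u in A) f u <= m -> n * #|[set u in A | n < D * f u]| <= D * m.
Proof.
move=> le_m; apply: leq_trans (leq_mul (leqnn D) le_m).
rewrite mulnC -sum_nat_const big_distrr /= [X in X <= _]big_mkcond [X in _ <= X]big_mkcond.
apply: leq_sum => u _; rewrite inE; case: (u \in A) => //=.
by case: ifP => // /ltnW.
Qed.

Section Core.
Variables (V : finType) (G : sgraph V).
Local Notation n := #|V|.
Implicit Types (A B Y : {set V}).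

Definition missing B (u : V) : nat := #|[set v in B | ~~ adj G u v]|.

Lemma card_nbrs_missing B u : #|nbrs G B u| + missing B u = #|B|.
Proof.
rewrite -(cardsID [set v | adj G u v] B); congr (_ + _); apply: eq_card => v.
  by rewrite !inE.
by rewrite !inE andbC.
Qed.

Lemma missingS A B u : A \subset B -> missing A u <= missing B u.
Proof.
move=> /subsetP AB; apply: subset_leq_card; apply/subsetP => v.
by rewrite !inE => /andP[/AB-> ->].
Qed.

Lemma sum_missing_sym A B :
  \sum_(u in A) missing B u = \sum_(v in B) missing A v.
Proof.
have E C D : \sum_(u in C) missing D u = \sum_(u in C) \sum_(v in D) ~~ adj G u v.
  apply: eq_bigr => u _; rewrite /missing -sum1_card big_mkcond [RHS]big_mkcond /=.
  by apply: eq_bigr => v _; rewrite inE; case: (v \in D); case: adj.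
rewrite !E exchange_big /=; apply: eq_bigr => u _; apply: eq_bigr => v _.
by rewrite adj_sym.
Qed.

(** The bound [n / D] on missing neighbours is multiplied out to stay in [nat]. *)
Definition dense_pair (D : nat) A B :=
  (forall a, a \in A -> D * missing B a <= n) /\
  (forall b, b \in B -> D * missing A b <= n).

Lemma dense_pair_sym D A B : dense_pair D A B -> dense_pair D B A.
Proof. by case. Qed.

(** Since [|A| * |B| <= n^2 / 4], at most [c * n / 4] pairs across are missing. By Markov's
    inequality at most [D * c / 4] vertices per side miss more than [n / D], and these are
    discarded. *)
Lemma dense_core (D c q : nat) A B : 0 < D -> 5 * D * c <= n ->
  [disjoint A & B] -> #|~: (A :|: B)| <= q ->
  n ^ 2 <= 4 * (\sum_(u in A) #|nbrs G B u|) + c * n ->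
  exists A0 B0, [/\ [disjoint A0 & B0], #|~: (A0 :|: B0)| <= q + D * c,
    dense_pair D A0 B0, n <= 5 * #|A0| & n <= 5 * #|B0|].
Proof.
move=> D0 nD dAB qAB nE; set E := \sum_(u in A) _ in nE.
have [n0|n0] := posnP n.
  exists A, B; rewrite n0 !leq0n; split=> //; first by rewrite (leq_trans qAB) ?leq_addr.
  by split=> a _; rewrite (leq_trans (leq_mul (leqnn D) (max_card _))) // n0 muln0.
have cAB : #|A| + #|B| <= n.
  by rewrite -cardsUI (disjoint_setI0 dAB) cards0 addn0 max_card.
set M := \sum_(u in A) missing B u.
have ME : E + M = #|A| * #|B|.
  rewrite -big_split /= -sum_nat_const; apply: eq_bigr => u _.
  exact: card_nbrs_missing.
have AB4 : 4 * (#|A| * #|B|) <= n ^ 2.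
  by apply: leq_trans (nat_AGM2 _ _) _; rewrite leq_exp2r.
have M4 : 4 * M <= c * n by lia.
have MA := @markov_card V A (missing B) n D M (leqnn _).
have MB := @markov_card V B (missing A) n D M.
rewrite -sum_missing_sym in MB; have {}MB := MB (leqnn _).
move: MA MB; set A1 := [set u in A | _]; set B1 := [set u in B | _] => MA MB.
have A1c : 4 * #|A1| <= D * c by rewrite -(leq_pmul2l n0); nia.
have B1c : 4 * #|B1| <= D * c by rewrite -(leq_pmul2l n0); nia.
have c5 : 5 * c <= n by nia.
(* For [a < n / 4] the product is below [3 * n^2 / 16], whereas
   [E >= (n^2 - c * n) / 4 >= n^2 / 5]. *)
have big a b : a + b <= n -> E <= a * b -> n <= 4 * a.
  move=> ab Eab; rewrite leqNgt; apply/negP => lt.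
  have : 5 * (c * n) <= n ^ 2 by rewrite -mulnn mulnA leq_mul2r c5 orbT.
  have : a * b <= a * (n - a) by rewrite leq_mul2l; lia.
  have : 0 < (n - 4 * a) * (n - a) by rewrite muln_gt0; lia.
  by nia.
have A4 : n <= 4 * #|A| by apply: big cAB _; rewrite -ME leq_addr.
have B4 : n <= 4 * #|B|.
  by apply: (big _ #|A|); rewrite 1?addnC // mulnC -ME leq_addr.
have sub1 : A1 \subset A by apply/subsetP => u; rewrite inE => /andP[].
have sub2 : B1 \subset B by apply/subsetP => u; rewrite inE => /andP[].
exists (A :\: A1), (B :\: B1); split.
- apply: disjointWl (subsetDl _ _) _; apply: disjointWr (subsetDl _ _) dAB.
- have : #|~: (A :\: A1 :|: B :\: B1)| <= #|~: (A :|: B) :|: (A1 :|: B1)|.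
    apply: subset_leq_card; apply/subsetP => u; rewrite !inE.
    case: (u \in A); case: (u \in B) => //=; rewrite ?andbF ?andbT ?orbF ?negbK //.
    by rewrite negb_or !negbK => /andP[->].
  have := (leq_card_setU (~: (A :|: B)) (A1 :|: B1)).1.
  by have := (leq_card_setU A1 B1).1; lia.
- split=> a; rewrite !inE => /andP[h aA]; rewrite aA -leqNgt in h;
    by apply: leq_trans h; rewrite leq_mul2l missingS ?orbT // subsetDl.
- by rewrite cardsD (setIidPr sub1); lia.
- by rewrite cardsD (setIidPr sub2); lia.
Qed.

Lemma card_nbrs_ge D A B A1 u : dense_pair D A B -> A1 \subset B -> u \in A ->
  D * #|A1| <= n + D * #|nbrs G A1 u|.
Proof.
case=> dA _ sub uA; have := missingS u sub; have := dA u uA.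
rewrite -(card_nbrs_missing A1 u); nia.
Qed.

Lemma alternating_path D A B A1 B1 Y m x : dense_pair D A B ->
  A1 \subset A -> B1 \subset B ->
  n + D * (#|Y| + m) < D * #|A1| -> n + D * (#|Y| + m) < D * #|B1| ->
  x \in A1 -> x \notin Y ->
  exists p, [/\ size p = m, path (adj G) x p, uniq (x :: p),
    forall y, y \in x :: p -> y \notin Y &
    forall i, i <= m -> nth x (x :: p) i \in if odd i then B1 else A1].
Proof.
move=> dAB sA sB cA cB xA xY.
apply: (@greedy_path _ (adj G) (fun i => if odd i then B1 else A1)) => // i z im /=.
case: (odd i) => /= zi.
  have := card_nbrs_ge (dense_pair_sym dAB) sA (subsetP sB z zi).
  by rewrite -/(nbrs G A1 z); nia.
have := card_nbrs_ge dAB sB (subsetP sA z zi).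
by rewrite -/(nbrs G B1 z); nia.
Qed.

(** The seed [s0] can be completed to a [k]-cycle around any [M] forbidden vertices, so disjoint
    seeds can be completed one after another. *)
Definition extensible (k M : nat) (s0 : seq V) :=
  forall Y, #|Y| <= M -> (forall y, y \in s0 -> y \notin Y) ->
  exists s, [/\ size s = k, cycle (adj G) s, uniq s, {subset s0 <= s} &
    forall y, y \in s -> y \notin Y].

(** A path of odd length [2 * l - 1] alternating between the two neighbourhoods of [v] starts in one
    and ends in the other, so it closes up through [v]. *)
Lemma hub_extensible D A B M l v : 0 < l -> dense_pair D A B ->
  n + D * (M + 2 * l + 1) < D * #|nbrs G A v| ->
  n + D * (M + 2 * l + 1) < D * #|nbrs G B v| ->
  extensible (2 * l + 1) M [:: v].
Proof.
move=> l0 dAB cA cB Y YM vY.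
have cY : #|v |: Y| <= M + 1 by rewrite cardsU1 addnC leq_add // leq_b1.
have [x xA xY] : exists2 x, x \in nbrs G A v & x \notin v |: Y.
  by apply: exists_outside; nia.
have [||||p [sp pp up pY pX]] := @alternating_path D A B (nbrs G A v) (nbrs G B v)
   (v |: Y) (2 * l - 1) x dAB _ _ _ _ xA xY.
- by apply/subsetP => z; rewrite inE => /andP[].
- by apply/subsetP => z; rewrite inE => /andP[].
- by nia.
- by nia.
have lastB : last x p \in nbrs G B v.
  have := pX (2 * l - 1) (leqnn _); rewrite -{1}sp -last_nth.
  by have -> : odd (2 * l - 1) by lia.
exists (v :: x :: p); split.
- by rewrite /= sp; lia.
- rewrite /= rcons_path pp; move: xA lastB; rewrite !inE => /andP[_ ->] /andP[_].
  by rewrite adj_sym.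
- rewrite cons_uniq up andbT; apply/negP => /pY.
  by rewrite !inE eqxx.
- by move=> z; rewrite inE => /eqP->; rewrite mem_head.
- move=> z; rewrite inE => /orP[/eqP->|/pY]; first by apply: vY; rewrite mem_head.
  by rewrite !inE negb_or => /andP[].
Qed.

(** A path of even length [2 * l - 2] starts and ends in common neighbours of [u] and [v] inside
    [B]; the edge [uv] closes it to a cycle. For [l = 1] the path is one vertex and the cycle a
    triangle. *)
Lemma edge_extensible D A B M l u v : 0 < l -> dense_pair D A B -> adj G u v ->
  n + D * (M + 2 * l + 2) < D * #|A| ->
  n + D * (M + 2 * l + 2) < D * #|nbrs G (nbrs G B u) v| ->
  extensible (2 * l + 1) M [:: u; v].
Proof.
move=> l0 dAB uv cA cB Y YM uvY.
have cY : #|u |: (v |: Y)| <= M + 2.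
  by have := cardsU1 u (v |: Y); have := cardsU1 v Y; case: (_ \notin _); case: (_ \notin _); lia.
have [x xB xY] : exists2 x, x \in nbrs G (nbrs G B u) v & x \notin u |: (v |: Y).
  by apply: exists_outside; nia.
have [||||p [sp pp up pY pX]] := @alternating_path D B A (nbrs G (nbrs G B u) v) A
   (u |: (v |: Y)) (2 * l - 2) x (dense_pair_sym dAB) _ _ _ _ xB xY.
- by apply/subsetP => z; rewrite !inE => /andP[/andP[]].
- by [].
- by nia.
- by nia.
have lastB : last x p \in nbrs G (nbrs G B u) v.
  have := pX (2 * l - 2) (leqnn _); rewrite -{1}sp -last_nth.
  by have -> : odd (2 * l - 2) = false by lia.
exists (u :: v :: x :: p); split.
- by rewrite /= sp; lia.
- rewrite /= rcons_path uv pp; move: xB lastB; rewrite !inE.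
  by move=> /andP[_ ->] /andP[/andP[_ h] _]; rewrite adj_sym h.
- rewrite (cons_uniq u) (cons_uniq v) up andbT inE negb_or; apply/andP; split; last first.
    by apply/negP => /pY; rewrite !inE eqxx orbT.
  apply/andP; split; last by apply/negP => /pY; rewrite !inE eqxx.
  by apply: contraTneq uv => ->; rewrite adj_irrefl.
- by move=> z; rewrite !inE => /orP[] /eqP->; rewrite eqxx ?orbT.
- move=> z; rewrite inE => /orP[/eqP->|]; first by apply: uvY; rewrite mem_head.
  rewrite inE => /orP[/eqP->|/pY]; first by apply: uvY; rewrite !inE eqxx orbT.
  by rewrite !inE !negb_or => /and3P[].
Qed.

(** Each seed is completed while avoiding the cycles already built and the seeds still waiting; [M]
    bounds the number of all these vertices. *)
Lemma seeds_packing (k M : nat) (ss : seq (seq V)) :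
  uniq (flatten ss) -> (forall s, s \in ss -> extensible k M s) ->
  size ss * k + size (flatten ss) <= M ->
  exists2 cs, cycle_packing G k cs & size cs = size ss.
Proof.
suff H cs : cycle_packing G k cs -> uniq (flatten cs ++ flatten ss) ->
    (forall s, s \in ss -> extensible k M s) ->
    (size cs + size ss) * k + size (flatten ss) <= M ->
    exists2 ds, cycle_packing G k ds & size ds = size cs + size ss.
  by move=> us ext le; apply: (H [::]).
elim: ss cs => [|s0 ss IH] cs pk; first by exists cs; rewrite ?addn0.
rewrite /= => ucs ext le; move: ucs.
rewrite !cat_uniq has_cat negb_or => /and3P[ucs /andP[nc1 nc2] /and3P[us0 ns uss]].
have [||s [sk cs_ us s0s sY]] :=
    ext s0 (mem_head _ _) [set z in flatten cs ++ flatten ss].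
- apply: leq_trans (card_set_seq _) _; rewrite size_cat.
  rewrite (@size_flatten_const _ k); last first.
    by move: pk => /andP[pk _]; apply: sub_all pk => ? /andP[].
  by move: le; rewrite size_cat; nia.
- move=> y ys0; rewrite inE mem_cat negb_or; apply/andP; split.
    by have /hasPn/(_ y ys0) := nc1.
  by apply: contra ns => yss; apply/hasP; exists y.
have ncs : ~~ has (mem s) (flatten cs).
  by apply/hasPn => y yc; apply/negP => /sY; rewrite inE mem_cat yc.
have nss : ~~ has (mem s) (flatten ss).
  by apply/hasPn => y yc; apply/negP => /sY; rewrite inE mem_cat yc orbT.
have [||||ds pd sd] := IH (s :: cs).
- move: pk => /andP[pk _]; rewrite /cycle_packing /= sk eqxx cs_ pk /=.
  by rewrite cat_uniq us ncs.
- rewrite /= -catA !cat_uniq us ucs uss has_cat negb_or ncs nss nc2 //.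
- by move=> z zs; apply: ext; rewrite inE zs orbT.
- by move: le; rewrite /= size_cat; nia.
by exists ds => //; rewrite sd /= addSnnS.
Qed.

Lemma free_seeds (t k M : nat) (ss : seq (seq V)) :
  Defs.free (copies t (cycle_graph k)) G ->
  uniq (flatten ss) -> (forall s, s \in ss -> extensible k M s) ->
  size ss * k + size (flatten ss) <= M -> size ss < t.
Proof.
move=> Gfree us ext le; have [cs pk <-] := seeds_packing us ext le.
exact: free_packing pk.
Qed.

End Core.

(** * Hubs and sides *)

Section CoreWeight.
Variables (V : finType) (G : sgraph V).
Local Notation n := #|V|.
Implicit Types (A B X Y : {set V}).

(** Each vertex of [X] misses at most [n / D] vertices of [A], so at most [q * n / D] are lost, and
    [Y] forbids at most [q] more. *)
Lemma common_neighbour D q A B X Y : dense_pair G D A B -> X \subset B ->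
  #|X| <= q -> #|Y| <= q -> q * n + D * q < D * #|A| ->
  exists2 a, a \notin Y & forall x, x \in X -> adj G a x.
Proof.
move=> [_ dB] XB Xq Yq big.
pose bad := [set a in A | 0 < missing G X a].
have badD : D * #|bad| <= q * n.
  have -> : #|bad| = \sum_(a in A) (0 < missing G X a).
    rewrite -sum1_card big_mkcond [RHS]big_mkcond; apply: eq_bigr => a _.
    by rewrite inE; case: (a \in A) => //=; case: ifP.
  apply: (@leq_trans (D * \sum_(a in A) missing G X a)).
    by rewrite leq_mul2l; apply/orP; right; apply: leq_sum => a _; case: (missing _ _ _).
  rewrite sum_missing_sym big_distrr /= (@leq_trans (\sum_(x in X) n)) //.
    by apply: leq_sum => x /(subsetP XB) /dB.
  by rewrite sum_nat_const leq_mul2r Xq orbT.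
have [|a aA] := @exists_outside V A (Y :|: bad).
  by have := (leq_card_setU Y bad).1; nia.
rewrite !inE aA negb_or /= -eqn0Ngt cards_eq0 => /andP[aY /eqP aX].
exists a => // x xX; apply: contraT => nax.
by have : x \in set0; [rewrite -aX inE xX nax | rewrite inE].
Qed.

Local Open Scope ring_scope.

(** The number [q] is the order of the forbidden graph, so [common_neighbour] lets any of its copies
    be rerouted: giving [v] the neighbourhood [B] keeps the graph free. *)
Lemma core_weight (R : realFieldType) (r : R) (x : V -> R) (t l D : nat) A B v
    (q := (t * (2 * l + 1))%N) :
  Defs.free (copies t (cycle_graph (2 * l + 1))) G ->
  perron_pair G r x -> spectral_bound V (copies t (cycle_graph (2 * l + 1))) r ->
  0 < r -> dense_pair G D A B -> (q * n + D * q < D * #|A|)%N ->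
  \sum_(w in B :\ v) x w <= r * x v.
Proof.
move=> Gfree px bound r0 dAB big; apply: rewire_weight px bound r0 _.
apply: rewire_free Gfree => X Y XB; rewrite card_prod !card_ord => Xq Yq.
exact: common_neighbour dAB XB Xq Yq big.
Qed.

End CoreWeight.

(** The matching is extended greedily; once this fails, its endpoints form a cover. *)
Lemma matching_or_cover (V : finType) (e : rel V) (m : nat) : irreflexive e ->
  (exists es : seq (V * V), [/\ size es = m,
     uniq (flatten [seq [:: p.1; p.2] | p <- es]) & all (fun p => e p.1 p.2) es]) \/
  exists2 C : {set V}, #|C| <= 2 * m & forall u v, e u v -> (u \in C) || (v \in C).
Proof.
move=> eirr; elim: m => [|m [[es [sz ues ees]]|[C Cm CE]]].
- by left; exists [::].
- pose C := [set z in flatten [seq [:: p.1; p.2] | p <- es]].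
  have [/existsP[u /existsP[v /and3P[uv uC vC]]]|h] :=
      boolP [exists u, exists v, [&& e u v, u \notin C & v \notin C]].
    left; exists ((u, v) :: es); split=> /=; rewrite ?sz ?uv //.
    rewrite !inE in uC vC; rewrite ues vC inE negb_or uC !andbT.
    by apply: contraTneq uv => ->; rewrite eirr.
  right; exists C.
    apply: leq_trans (card_set_seq _) _; rewrite -sz.
    by elim: (es) => //= p s IH; rewrite mulnS !ltnS.
  move=> u v uv; apply: contraNT h; rewrite negb_or => /andP[uC vC].
  by apply/existsP; exists u; apply/existsP; exists v; rewrite uv uC.
- by right; exists C => //; rewrite (leq_trans Cm) // leq_mul2l leqnSn.
Qed.

Lemma quadE (R : realFieldType) (V : finType) (e : rel V) (y : V -> R) :
  (quad e y = \sum_u \sum_v (e u v)%:R * (y u * y v))%R.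
Proof.
apply: eq_bigr => u _; rewrite big_mkcond; apply: eq_bigr => v _.
by case: (e u v); rewrite ?mul1r ?mul0r.
Qed.

(* Hubs have at least n / h neighbours on each side, core vertices miss at most
   n / D vertices of the opposite side with D much larger than h, and tau bounds
   the number of vertices outside the core. *)
Section Hubs.
Variables (R : realFieldType) (V : finType) (G : sgraph V).
Variables (r : R) (x : V -> R) (t l h D tau q : nat) (A0 B0 : {set V}).
Local Notation n := #|V|.
Hypothesis t0 : 0 < t.
Hypothesis l0 : 0 < l.
Hypothesis hE : h = 1000 * t.
Hypothesis qE : q = t * (2 * l + 1).
Hypothesis DE : D = 10 * (2 * l + 1) * h.
Hypothesis tauE : tau = q + D * (40 * q).
Hypothesis nbig : 1000 * h * tau <= n.
Hypothesis Gfree : Defs.free (copies t (cycle_graph (2 * l + 1))) G.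
Hypothesis px : perron_pair G r x.
Hypothesis bound : spectral_bound V (copies t (cycle_graph (2 * l + 1))) r.
Hypothesis dis0 : [disjoint A0 & B0].
Hypothesis cT : #|~: (A0 :|: B0)| <= tau.
Hypothesis dAB : dense_pair G D A0 B0.
Hypothesis bigA : n <= 5 * #|A0|.
Hypothesis bigB : n <= 5 * #|B0|.

Definition hubs : {set V} :=
  [set v | (n <= h * #|nbrs G A0 v|) && (n <= h * #|nbrs G B0 v|)].

Let tq : 3 * t <= q. Proof. by rewrite qE; nia. Qed.
Let lq : 2 * l + 1 <= q. Proof. by rewrite qE; nia. Qed.
Let q3 : 3 <= q. Proof. by lia. Qed.
Let D_q : D = 10 * (1000 * q).
Proof. by rewrite DE hE qE mulnACA [(2 * l + 1) * t]mulnC -mulnA. Qed.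
Let tau_ge : q + 100 * D <= tau.
Proof. by rewrite tauE leq_add2l mulnC leq_mul2l; apply/orP; right; lia. Qed.
Let n_tau : 1000 * (1000 * tau) <= n.
Proof. by apply: leq_trans nbig; rewrite hE -!mulnA !leq_mul2l /= leq_pmull. Qed.

Let Dq_n m : m <= 40 * q -> 1000 * (D * m) <= n.
Proof.
move=> mq; apply: leq_trans n_tau; rewrite leq_mul2l /=.
apply: (@leq_trans tau); last by rewrite leq_pmull.
by rewrite tauE (leq_trans (leq_mul (leqnn D) mq)) // leq_addl.
Qed.

Lemma hubs_extensible v : v \in hubs -> extensible G (2 * l + 1) (3 * q) [:: v].
Proof.
have n0 : 0 < n by lia.
(* The factor [10 * (2 * l + 1) >= 30] in [D] turns [n <= h * c] into [30 * n <= D * c], which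
   leaves ample room. *)
have large c : n <= h * c -> n + D * (3 * q + 2 * l + 1) < D * c.
  move=> hc; have D30 : 30 * n <= D * c.
    by rewrite DE -mulnA leq_mul //; lia.
  have : 1000 * (D * (3 * q + 2 * l + 1)) <= n by apply: Dq_n; lia.
  by move: D30; move: (D * c) (D * _) => a b; lia.
rewrite inE => /andP[vA vB].
by apply: (hub_extensible l0 dAB); apply: large.
Qed.

(** The room [3 * q] suffices: at most [t] cycles occupy [q] vertices, and the seeds at most
    [2 * t <= q]. *)
Lemma seeds_lt ss : uniq (flatten ss) -> size ss <= t ->
  (forall s, s \in ss -> size s <= 2 /\ extensible G (2 * l + 1) (3 * q) s) ->
  size ss < t.
Proof.
move=> us st ext; apply: (free_seeds Gfree us (M := 3 * q)) => [s /ext[]//|].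
apply: (@leq_trans (q + 2 * t)); last lia.
apply: leq_add; first by rewrite qE leq_mul2r st orbT.
apply: (@leq_trans (2 * size ss)); last by rewrite leq_mul2l st orbT.
elim: ss {us st} ext => //= s ss IH ext; rewrite size_cat mulnS leq_add //.
  by have [] := ext s (mem_head _ _).
by apply: IH => z zs; apply: ext; rewrite inE zs orbT.
Qed.

Lemma flatten_singletons (s : seq V) : flatten [seq [:: v] | v <- s] = s.
Proof. by elim: s => //= v s ->. Qed.

Lemma card_hubs : #|hubs| < t.
Proof.
rewrite ltnNge; apply/negP => th.
have st : size (take t (enum hubs)) = t by rewrite size_take -cardE; case: ltngtP th.
have : size [seq [:: v] | v <- take t (enum hubs)] < t; last first.
  by rewrite size_map st ltnn.
apply: seeds_lt.
- by rewrite flatten_singletons take_uniq // enum_uniq.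
- by rewrite size_map st.
- move=> s /mapP[v vh ->]; split=> //; apply: hubs_extensible.
  by rewrite -mem_enum; apply: mem_take vh.
Qed.

Let big_core (C : {set V}) : n <= 5 * #|C| -> q * n + D * q < D * #|C|.
Proof.
move=> nC; have n0 : 0 < n by lia.
have : 1000 * (D * q) <= n by apply: Dq_n; lia.
have : D * n <= 5 * (D * #|C|) by rewrite mulnCA leq_mul2l nC orbT.
rewrite D_q -!mulnA; have : n <= q * n by rewrite leq_pmull; lia.
move: (q * n) (q * q) (q * #|C|) => a b c; lia.
Qed.

Local Open Scope ring_scope.

Lemma core_weightA v : 0 < r -> \sum_(w in A0 :\ v) x w <= r * x v.
Proof.
move=> r0; have := core_weight v Gfree px bound r0 (dense_pair_sym dAB).
by rewrite -qE; apply; exact: big_core.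
Qed.

Lemma core_weightB v : 0 < r -> \sum_(w in B0 :\ v) x w <= r * x v.
Proof.
move=> r0; have := core_weight v Gfree px bound r0 dAB.
by rewrite -qE; apply; exact: big_core.
Qed.

(** * Weights and degrees under a Perron vector with maximum 1 outside the hubs *)

Variable vs : V.
Hypothesis vsN : vs \notin hubs.
Hypothesis xvs : x vs = 1.
Hypothesis xoff : forall u, u \notin hubs -> x u <= 1.
Hypothesis x3 : forall u, x u <= 3.

Let x0 u : 0 <= x u. Proof. by case: px. Qed.
Let nr : n%:R <= 2 * r + 1.
Proof. by apply: (half_le_spectral_bound t0 l0 _ bound); lia. Qed.
Let n1000 : 1000 <= n%:R :> R. Proof. by rewrite ler_nat; lia. Qed.
Let r0 : 0 < r. Proof. by have := n1000; have := nr; lra. Qed.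

Let n_tauR : 1000 * (1000 * tau%:R) <= n%:R :> R.
Proof. by rewrite -!natrM ler_nat. Qed.
Let t_tauR : t%:R <= tau%:R :> R.
Proof. by rewrite ler_nat; move: tau_ge tq; clear; lia. Qed.
Let tau1 : 1 <= tau%:R :> R.
Proof. by rewrite ler1n; move: tau_ge q3; clear; lia. Qed.

Let sum_le (S : {set V}) : \sum_(u in S) x u <= #|S|%:R + 2 * t%:R.
Proof.
apply: (@le_trans _ _ (\sum_(u in S) (1 + 2 * (u \in hubs)%:R))).
  apply: ler_sum => u _; case: (boolP (u \in hubs)) => uh; last by have := xoff uh; rewrite /=; lra.
  by have := x3 u; rewrite /=; lra.
rewrite big_split /= sumr_const lerD //.
rewrite -mulr_sumr ler_wpM2l // -natr_sum ler_nat.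
apply: (@leq_trans #|hubs|); last exact: ltnW card_hubs.
rewrite -sum1_card big_mkcond [X in (_ <= X)%N]big_mkcond /=; apply: leq_sum => u _.
by case: (u \in S); case: (u \in hubs).
Qed.

(** The vertex [vs] has weight 1 and at most [n / h] neighbours in [C], so nearly all of its
    neighbour sum [r] comes from [C']. Rewiring [u] onto [C'] bounds that weight by about
    [r * x u]. *)
Lemma weight_lower_aux (C C' : {set V}) u :
  (#|~: (C :|: C')| <= tau)%N -> (h * #|nbrs G C vs| <= n)%N ->
  (forall v, \sum_(w in C' :\ v) x w <= r * x v) ->
  900 * (r - r * x u) <= n%:R.
Proof.
move=> cCC hC wC'; have [_ _ eig] := px.
have rE : r <= \sum_(w in C') x w + 3 * tau%:R + (#|nbrs G C vs|%:R + 2 * t%:R).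
  have -> : r = \sum_(w | adj G vs w) x w by rewrite eig xvs mulr1.
  apply: (@le_trans _ _ (\sum_(w in C') x w + \sum_(w in ~: (C :|: C')) x w +
      \sum_(w in nbrs G C vs) x w)).
    rewrite big_mkcond [X in _ <= X + _ + _]big_mkcond [X in _ <= _ + X + _]big_mkcond.
    rewrite [X in _ <= _ + _ + X]big_mkcond -!big_split /=; apply: ler_sum => w _.
    rewrite !inE; have := x0 w.
    by case: (w \in C); case: (w \in C'); case: (adj G vs w) => /=; lra.
  apply: lerD; last exact: sum_le.
  apply: lerD => //.
  apply: (@le_trans _ _ (\sum_(w in ~: (C :|: C')) 3)); first exact: ler_sum.
  by rewrite sumr_const -[3 *+ _]mulr_natr ler_wpM2l // ler_nat.
have wu : \sum_(w in C') x w <= r * x u + 3.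
  apply: (@le_trans _ _ (\sum_(w in C' :\ u) x w + 3)); last by rewrite lerD.
  have [uC|uC] := boolP (u \in C'); first by rewrite (big_setD1 u) //= addrC lerD.
  by rewrite (setDidPl _) ?lerDl // disjoint_sym disjoints1.
have : 1000 * #|nbrs G C vs|%:R <= n%:R :> R.
  rewrite -natrM ler_nat; apply: leq_trans hC; rewrite hE leq_mul2r.
  by apply/orP; right; rewrite leq_pmulr.
move: rE wu n_tauR t_tauR tau1 n1000; lra.
Qed.

Lemma weight_lower u : 900 * (r - r * x u) <= n%:R.
Proof.
have := vsN; rewrite inE negb_and -!ltnNge => /orP[] /ltnW small.
  apply: (weight_lower_aux u cT small) => v; exact: core_weightB.
apply: (@weight_lower_aux B0 A0 u _ small) => [|v]; last exact: core_weightA.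
by rewrite setUC.
Qed.

Lemma half_le_weight u : 1 / 2 <= x u.
Proof. by move: (weight_lower u) nr n1000 r0 (x0 u); nra. Qed.

(** Off the hubs weights are at most 1, so the degree of [u] is at least about [r * x u], hence
    close to [n / 2]; few of these neighbours lie in [C] or outside the core. *)
Lemma core_degree (C C' : {set V}) u :
  (#|~: (C :|: C')| <= tau)%N -> (h * #|nbrs G C u| <= n)%N ->
  (49 * n <= 100 * #|nbrs G C' u|)%N.
Proof.
move=> cCC hC; have [_ _ eig] := px.
have : r * x u <= #|nbrs G setT u|%:R + 2 * t%:R.
  rewrite -eig; apply: le_trans (sum_le _); rewrite le_eqVlt; apply/orP; left.
  by apply/eqP/eq_bigl => w; rewrite !inE /=.
have : #|nbrs G setT u|%:R <= #|nbrs G C u|%:R + #|nbrs G C' u|%:R + tau%:R :> R.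
  rewrite -!natrD ler_nat; apply: (@leq_trans #|nbrs G C u :|: nbrs G C' u :|: ~: (C :|: C')|).
    apply: subset_leq_card; apply/subsetP => w; rewrite !inE /= => ->.
    by case: (w \in C); case: (w \in C').
  apply: (leq_trans (leq_card_setU _ _)); apply: leq_add => //.
  exact: leq_card_setU.
have : 1000 * #|nbrs G C u|%:R <= n%:R :> R.
  rewrite -natrM ler_nat; apply: leq_trans hC; rewrite hE leq_mul2r.
  by apply/orP; right; rewrite leq_pmulr.
rewrite -(ler_nat R) (natrM _ 49) (natrM _ 100).
move: (weight_lower u) n_tauR t_tauR tau1 n1000 nr; lra.
Qed.

(** * The two sides and the edges inside them *)

Local Open Scope nat_scope.

(** Sides are defined by degrees into the core, not by membership in it, so that every non-hub, even
    outside the core, belongs to one. *)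
Definition sideA : {set V} := [set v | (v \notin hubs) && (h * #|nbrs G A0 v| < n)].
Definition sideB : {set V} := ~: (hubs :|: sideA).

Let n_pos : 0 < n. Proof. by move: n_tau tau_ge q3; clear; lia. Qed.

Let sideA_low u : u \in sideA -> h * #|nbrs G A0 u| <= n.
Proof. by rewrite inE => /andP[_ /ltnW]. Qed.

Let sideB_low u : u \in sideB -> h * #|nbrs G B0 u| <= n.
Proof.
rewrite in_setC in_setU negb_or => /andP[uh]; rewrite inE uh /= -leqNgt => hA.
by move: uh; rewrite inE hA /= -ltnNge => /ltnW.
Qed.

Let cT' : #|~: (B0 :|: A0)| <= tau. Proof. by rewrite setUC. Qed.

Let degA u : u \in sideA -> 49 * n <= 100 * #|nbrs G B0 u|.
Proof. by move/sideA_low; apply: core_degree. Qed.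

Let degB u : u \in sideB -> 49 * n <= 100 * #|nbrs G A0 u|.
Proof. by move/sideB_low; apply: core_degree. Qed.

Let core_high (C C' : {set V}) u : dense_pair G D C C' -> n <= 5 * #|C'| ->
  u \in C -> n <= h * #|nbrs G C' u|.
Proof.
move=> dCC nC uC.
have := card_nbrs_ge dCC (subxx C') uC.
have n5 : D * n <= 5 * (D * #|C'|) by rewrite mulnCA leq_mul2l nC orbT.
move=> h1; rewrite leqNgt; apply/negP => h2.
have e1 : D * #|nbrs G C' u| <= 10 * ((2 * l + 1) * n).
  by rewrite DE -!mulnA !leq_mul2l ltnW ?orbT.
have e2 : 1000 * (10 * ((2 * l + 1) * n)) <= D * n.
  rewrite DE -!mulnA mulnCA leq_mul2l /= mulnCA leq_mul2l; apply/orP; right.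
  by rewrite leq_mul2r hE leq_pmulr ?orbT.
have e3 : n <= (2 * l + 1) * n by rewrite leq_pmull // addn1.
move: n5 h1 e1 e2 e3 n_pos; move: (D * n) (D * #|C'|) (D * _) ((2 * l + 1) * n).
by clear; lia.
Qed.

Let coreA_side u : u \in A0 -> u \notin hubs -> u \in sideA.
Proof.
move=> uA uh; rewrite inE uh ltnNge; apply: contra uh => uA'.
by rewrite inE uA' (core_high dAB).
Qed.

Let coreB_side u : u \in B0 -> u \notin hubs -> u \in sideB.
Proof.
move=> uB uh; rewrite in_setC in_setU negb_or uh /= inE uh /= -leqNgt.
exact: core_high (dense_pair_sym dAB) bigA uB.
Qed.

Let exists_core (C : {set V}) : n <= 5 * #|C| -> exists2 u, u \in C & u \notin hubs.
Proof.
move=> nC; apply: exists_outside; apply: leq_trans card_hubs _.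
by move: tq tau_ge n_tau n_pos nC; clear; lia.
Qed.

Let halfA : 49 * n <= 100 * #|A0|.
Proof.
have [u uB /(coreB_side uB) /degB] := exists_core bigB.
by move/leq_trans; apply; rewrite leq_mul2l subset_leq_card ?orbT //;
  apply/subsetP => w; rewrite inE => /andP[].
Qed.

Let halfB : 49 * n <= 100 * #|B0|.
Proof.
have [u uA /(coreA_side uA) /degA] := exists_core bigA.
by move/leq_trans; apply; rewrite leq_mul2l subset_leq_card ?orbT //;
  apply/subsetP => w; rewrite inE => /andP[].
Qed.

Let sum_core : #|A0| + #|B0| <= n.
Proof. by rewrite -cardsUI (disjoint_setI0 dis0) cards0 addn0 max_card. Qed.

(** Two neighbourhoods of size at least [0.49 n] within a set of at most [0.51 n] vertices share at
    least [0.47 n]. *)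
Let edge_ext (C C' : {set V}) u v : dense_pair G D C C' ->
  49 * n <= 100 * #|C| -> 49 * n <= 100 * #|nbrs G C' u| ->
  49 * n <= 100 * #|nbrs G C' v| -> 100 * #|C'| <= 51 * n -> adj G u v ->
  extensible G (2 * l + 1) (3 * q) [:: u; v].
Proof.
move=> dCC nC nu nv nC' uv.
have large c : n <= 5 * c -> n + D * (3 * q + 2 * l + 2) < D * c.
  move=> nc; have n5 : D * n <= 5 * (D * c) by rewrite mulnCA leq_mul2l nc orbT.
  have : 1000 * (D * (3 * q + 2 * l + 2)) <= n.
    by apply: Dq_n; move: lq q3; clear; lia.
  have : 100 * n <= D * n by rewrite leq_mul2r; apply/orP; right; move: D_q q3; clear; lia.
  by move: n5 n_pos; move: (D * n) (D * c) (D * _) => a b d; clear; lia.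
apply: (edge_extensible l0 dCC uv); apply: large.
  by move: nC n_pos; clear; lia.
have -> : nbrs G (nbrs G C' u) v = nbrs G C' u :&: nbrs G C' v.
  by apply/setP => w; rewrite !inE; case: (w \in C'); case: (adj G u w).
have : #|nbrs G C' u :|: nbrs G C' v| <= #|C'|.
  by apply: subset_leq_card; apply/subsetP => w; rewrite !inE -andb_orr => /andP[].
have := cardsUI (nbrs G C' u) (nbrs G C' v).
by move: nu nv nC' n_pos; clear; lia.
Qed.

Definition inner : rel V := fun u v => adj G u v &&
  ((u \in sideA) && (v \in sideA) || (u \in sideB) && (v \in sideB)).

Lemma inner_sym : symmetric inner.
Proof.
move=> u v; rewrite /inner adj_sym [(u \in sideA) && _]andbC.
by rewrite [(u \in sideB) && _]andbC.
Qed.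

Lemma inner_extensible u v : inner u v -> extensible G (2 * l + 1) (3 * q) [:: u; v].
Proof.
case/andP=> uv /orP[] /andP[us vs'].
  apply: (edge_ext dAB _ (degA us) (degA vs') _ uv) => //.
  by move: halfA sum_core; clear; lia.
apply: (edge_ext (dense_pair_sym dAB) _ (degB us) (degB vs') _ uv) => //.
by move: halfB sum_core; clear; lia.
Qed.

(** A non-hub of the opposite core lies on the opposite side. So inner neighbours are among the at
    most [n / h] neighbours in the own core and the at most [tau] vertices outside both cores. *)
Lemma inner_degree u : 900 * t * #|[set v | inner u v]| <= n.
Proof.
suff H (C : {set V}) : h * #|nbrs G C u| <= n ->
    [set v | inner u v] \subset nbrs G C u :|: ~: (A0 :|: B0) ->
    900 * t * #|[set v | inner u v]| <= n.
  have [uA|uA] := boolP (u \in sideA).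
    apply: (H A0 (sideA_low uA)); apply/subsetP => w; rewrite in_set => /andP[uw].
    have -> : (u \in sideB) = false by rewrite inE in_setU uA orbT.
    rewrite /= orbF => /andP[_ wA]; rewrite 2!inE uw andbT.
    have [//|wA0] := boolP (w \in A0); rewrite in_setC in_setU (negbTE wA0) /=.
    move: (wA); rewrite inE => /andP[wh _]; apply: contraL wA => /coreB_side/(_ wh).
    by rewrite in_setC in_setU negb_or => /andP[].
  have [uB|uB] := boolP (u \in sideB).
    apply: (H B0 (sideB_low uB)); apply/subsetP => w; rewrite in_set => /andP[uw].
    rewrite (negbTE uA) /= => /andP[_ wB]; rewrite 2!inE uw andbT.
    have [//|wB0] := boolP (w \in B0); rewrite in_setC in_setU (negbTE wB0) orbF /=.
    move: (wB); rewrite in_setC in_setU negb_or => /andP[wh wA].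
    by apply: contra wA => /coreA_side/(_ wh).
  rewrite (_ : [set v | inner u v] = set0) ?cards0 ?muln0 //.
  by apply/setP => w; rewrite !in_set0 in_set /inner (negbTE uA) (negbTE uB) andbF.
move=> low /subset_leq_card; have := (leq_card_setU (nbrs G C u) (~: (A0 :|: B0))).1.
move: low; move: #|[set v | _]| #|_ :|: _| (#|nbrs G C u|) => a b c low bc ab.
have ac : a <= c + tau by apply: leq_trans ab (leq_trans bc _); rewrite leq_add2l.
have h1 : h * a <= n + h * tau.
  by apply: leq_trans (leq_mul (leqnn h) ac) _; rewrite mulnDr leq_add2r.
move: h1 nbig; rewrite -[1000 * h * tau]mulnA.
have -> : h * a = 1000 * (t * a) by rewrite hE mulnA.
rewrite -[900 * t * a]mulnA.
move: (h * tau) (t * a) n_pos => x1 x2; clear; lia.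
Qed.

(** Supplies the vertex to be promoted to a hub: its missing neighbours on its own side are the
    edges gained. *)
Lemma many_missing : exists2 w, w \in sideA & 4 * n <= 10 * missing G sideA w.
Proof.
have [w wA0 wh] := exists_core bigA; have wA := coreA_side wA0 wh.
exists w => //; have := card_nbrs_missing G (A0 :\: hubs) w.
have := cardsID hubs A0.
have sub : A0 :\: hubs \subset sideA.
  by apply/subsetP => u; rewrite in_setD => /andP[uh uA]; apply: coreA_side.
have := missingS G w sub.
have : #|nbrs G (A0 :\: hubs) w| <= #|nbrs G A0 w|.
  by apply: subset_leq_card; apply/subsetP => u; rewrite !in_set => /andP[/andP[_ ->]].
have : #|A0 :&: hubs| <= t.
  by apply: leq_trans (ltnW card_hubs); apply: subset_leq_card; apply: subsetIr.
have : 1000 * #|nbrs G A0 w| <= n.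
  by apply: leq_trans (sideA_low wA); rewrite hE leq_mul2r leq_pmulr ?orbT.
by move: halfA tq tau_ge n_tau; clear; lia.
Qed.

Lemma inner_notin_hubs u v : inner u v -> (u \notin hubs) && (v \notin hubs).
Proof.
have hA z : z \in sideA -> z \notin hubs by rewrite in_set => /andP[].
have hB z : z \in sideB -> z \notin hubs by rewrite in_setC in_setU negb_or => /andP[].
by case/andP=> _ /orP[] /andP[] => [/hA-> /hA->|/hB-> /hB->].
Qed.

Lemma hub_edge_seeds (es : seq (V * V)) :
  uniq (flatten [seq [:: p.1; p.2] | p <- es]) -> all (fun p => inner p.1 p.2) es ->
  #|hubs| + size es <= t -> #|hubs| + size es < t.
Proof.
move=> ues /allP ees le; pose pairs := [seq [:: p.1; p.2] | p <- es].
have sz : size ([seq [:: v] | v <- enum hubs] ++ pairs) = #|hubs| + size es.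
  by rewrite size_cat !size_map -cardE.
rewrite -sz; apply: seeds_lt; last 1 first.
- move=> s; rewrite mem_cat => /orP[] /mapP[p pin ->]; split=> //.
    by apply: hubs_extensible; rewrite -mem_enum.
  exact/inner_extensible/ees.
- rewrite flatten_cat flatten_singletons cat_uniq enum_uniq ues andbT /=.
  apply/hasPn => z /flattenP[s /mapP[p /ees/inner_notin_hubs/andP[h1 h2] ->]].
  by rewrite in_cons mem_seq1 /= mem_enum => /orP[] /eqP->.
- by rewrite sz.
Qed.

(** * Exactly t-1 hubs and independent sides *)

Local Open Scope ring_scope.

(** The competitor when hubs are too few: once the hubs and [w] are removed, the sides 2-colour
    it. *)
Definition add_hub (w : V) : sgraph V :=
  sgraph_of_rel (fun u v => [|| u == w, v == w | adj G u v && ~~ inner u v]).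

Let adj_add_hub w u v :
  adj (add_hub w) u v = (u != v) && [|| u == w, v == w | adj G u v && ~~ inner u v].
Proof.
rewrite adj_of_rel; congr (_ && _); rewrite (adj_sym G v) (inner_sym v).
by case: (u == w); case: (v == w); case: (_ && _).
Qed.

Let add_hub_free w : (#|hubs|.+1 < t)%N ->
  Defs.free (copies t (cycle_graph (2 * l + 1))) (add_hub w).
Proof.
move=> ht; apply: (@bicolored_outside_free _ _ (fun u => u \in sideA) (w |: hubs)) => //.
  by rewrite cardsU1 (leq_ltn_trans _ ht) // -add1n leq_add2r leq_b1.
move=> u v; rewrite !in_setU1 !negb_or => /andP[uw uh] /andP[vw vh].
rewrite adj_add_hub (negbTE uw) (negbTE vw) /= => /and3P[_ uv].
apply: contra => /eqP uvA; rewrite /inner uv !in_setC !in_setU (negbTE uh) (negbTE vh) -uvA /=.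
by case: (_ \in _).
Qed.

(** Hubs together with [t - #|hubs|] disjoint inner edges would be [t] seeds, so boundedly many
    vertices cover the inner edges. With fewer than [t - 1] hubs, [add_hub] then gains more than it
    loses. *)
Lemma card_hubs_eq : #|hubs| = (t - 1)%N.
Proof.
apply/eqP; rewrite eqn_leq; apply/andP; split.
  by move: card_hubs; move: #|hubs| => a; clear; lia.
rewrite leqNgt; apply/negP => hlt.
have [w wA wm] := many_missing.
have [|[es [sz ues ees]]|[C Cm Ccov]] := @matching_or_cover V inner (t - #|hubs|).
- by move=> u; rewrite /inner adj_irrefl.
- have ht : (#|hubs| + size es = t)%N by rewrite sz subnKC // ltnW // card_hubs.
  by have := hub_edge_seeds ues ees; rewrite ht ltnn leqnn => /(_ isT).
have hlt1 : (#|hubs|.+1 < t)%N by move: hlt; clear; lia.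
have := bound x (add_hub_free w hlt1); rewrite -(quad_perron px) !quadE => bnd.
(* Only the new edges from [w] into [sideA], in one orientation, are counted; this is already
   enough. *)
pose gain v := [&& v \in sideA, ~~ adj G w v & v != w].
have point u v : (adj (add_hub w) u v)%:R >=
    (adj G u v)%:R - (inner u v)%:R + ((u == w) && gain v)%:R :> R.
  rewrite adj_add_hub /gain.
  have [uw|uw] := eqVneq u w; last first.
    rewrite /= addr0; have [->|uv] := eqVneq u v.
      by rewrite adj_irrefl /inner adj_irrefl subr0.
    rewrite /inner; set b := (_ || _); clearbody b.
    by case: (v == w); case: (adj G u v); case: b => /=; lra.
  rewrite uw [v == w]eq_sym; have [<-|wv] := eqVneq w v.
    by rewrite adj_irrefl /inner adj_irrefl !andbF /= subr0 addr0.
  rewrite /inner; set b := (_ || _); clearbody b.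
  by case: (v \in sideA); case: (adj G w v); case: b => /=; lra.
(* At most [2 * t] cover vertices, each on at most [n / (900 * t)] inner edges counted in two
   orientations, lose at most [n / 225]. *)
have inner_sum : 225 * \sum_u \sum_v (inner u v)%:R * (x u * x v) <= n%:R.
  pose N := (\sum_u \sum_v inner u v)%N.
  apply: (@le_trans _ _ (225 * N%:R)).
    rewrite ler_wpM2l // natr_sum ler_sum // => u _; rewrite natr_sum ler_sum // => v _.
    have [/inner_notin_hubs/andP[uh vh]|_] := boolP (inner u v); last by rewrite mul0r.
    by rewrite mul1r mulr_ile1 // xoff.
  rewrite -natrM ler_nat -(leq_pmul2l t0) mulnCA.
  have NC : (N <= 2 * \sum_(u in C) #|[set v | inner u v]|)%N.
    have degE u : #|[set v | inner u v]| = (\sum_v inner u v)%N.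
      rewrite -sum1_card big_mkcond; apply: eq_bigr => v _.
      by rewrite inE; case: (inner u v).
    have CE : (\sum_(u in C) #|[set v | inner u v]| = \sum_u \sum_v (u \in C) * inner u v)%N.
      rewrite big_mkcond; apply: eq_bigr => u _; rewrite degE -big_distrr /=.
      by case: (u \in C); rewrite ?mul1n ?mul0n.
    have CE' : (\sum_(u in C) #|[set v | inner u v]| = \sum_u \sum_v (v \in C) * inner u v)%N.
      rewrite CE exchange_big; apply: eq_bigr => u _; apply: eq_bigr => v _.
      by rewrite inner_sym.
    rewrite mul2n -addnn {1}CE CE' -big_split /=; apply: leq_sum => u _.
    rewrite -big_split /=; apply: leq_sum => v _.
    by have := Ccov u v; case: (inner u v) => // /(_ isT); case: (u \in C); case: (v \in C).
  have : (900 * t * N <= 2 * (#|C| * n))%N.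
    apply: leq_trans (leq_mul (leqnn _) NC) _; rewrite mulnCA leq_mul2l /=.
    rewrite big_distrr /= -sum_nat_const; apply: leq_sum => u _; exact: inner_degree.
  have : (#|C| * n <= 2 * (t * n))%N.
    rewrite mulnA leq_mul2r; apply/orP; right; apply: leq_trans Cm _.
    by rewrite leq_mul2l leq_subr orbT.
  by rewrite -mulnA; move: (t * N)%N (t * n)%N (#|C| * n)%N; clear; lia.
(* About [0.4 n] new pairs, each of weight at least [1 / 4] by [half_le_weight]. *)
have gain_sum : n%:R * (4 / 10) - 1 <= 4 * \sum_u \sum_v ((u == w) && gain v)%:R * (x u * x v).
  have -> : \sum_u \sum_v ((u == w) && gain v)%:R * (x u * x v) =
      \sum_v (gain v)%:R * (x w * x v).
    rewrite (bigD1 w) //= eqxx -[RHS]addr0; congr (_ + _).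
    by apply: big1 => u /negbTE uw; apply: big1 => v _; rewrite uw mul0r.
  apply: (@le_trans _ _ (#|[set v | gain v]|%:R)).
    have : (missing G sideA w <= #|[set v | gain v]| + 1)%N.
      rewrite /missing (cardsD1 w) addnC leq_add ?leq_b1 //.
      apply: subset_leq_card; apply/subsetP => v.
      by rewrite in_setD1 2!in_set /gain => /and3P[-> -> ->].
    move: wm; rewrite -(ler_nat R) (natrM _ 4) (natrM _ 10) => wm.
    by rewrite -(ler_nat R) natrD; move: wm; lra.
  rewrite mulr_sumr -sum1_card natr_sum big_mkcond ler_sum // => v _.
  rewrite inE; case: (gain v); last by rewrite mul0r mulr0.
  by rewrite mul1r; move: (half_le_weight w) (half_le_weight v); nra.
have : \sum_u \sum_v ((adj G u v)%:R - (inner u v)%:R + ((u == w) && gain v)%:R) * (x u * x v)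
   <= \sum_u \sum_v (adj (add_hub w) u v)%:R * (x u * x v).
  by apply: ler_sum => u _; apply: ler_sum => v _; rewrite ler_wpM2r // mulr_ge0.
have -> : \sum_u \sum_v ((adj G u v)%:R - (inner u v)%:R + ((u == w) && gain v)%:R) * (x u * x v)
  = \sum_u \sum_v (adj G u v)%:R * (x u * x v) - \sum_u \sum_v (inner u v)%:R * (x u * x v)
  + \sum_u \sum_v ((u == w) && gain v)%:R * (x u * x v).
  rewrite -sumrB -big_split /=; apply: eq_bigr => u _.
  by rewrite -sumrB -big_split /=; apply: eq_bigr => v _; rewrite mulrDl mulrBl.
move: bnd inner_sum gain_sum n1000; lra.
Qed.

Lemma no_inner u v : ~~ inner u v.
Proof.
apply/negP => uv; have := @hub_edge_seeds [:: (u, v)]; rewrite /= uv card_hubs_eq inE !andbT.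
rewrite addn1 subn1 prednK // ltnn => H.
suff : false by []. apply: H => //.
by apply: contraTneq uv => ->; rewrite /inner adj_irrefl.
Qed.

End Hubs.

(** * Structure of extremal graphs for large n *)

Local Open Scope ring_scope.

(** This is [1000 * h * tau] with the parameters of the hub analysis unfolded. *)
Definition threshold (t l : nat) : nat :=
  (1000 * (1000 * t) *
   (t * (2 * l + 1) + 10 * (2 * l + 1) * (1000 * t) * (40 * (t * (2 * l + 1)))))%N.

Lemma bipartite_outside_hubs (R : realFieldType) (V : finType) (G : sgraph V)
    (r : R) (x : V -> R) (t l : nat) : (0 < t)%N -> (0 < l)%N ->
  (threshold t l <= #|V|)%N ->
  Defs.free (copies t (cycle_graph (2 * l + 1))) G -> perron_pair G r x ->
  spectral_bound V (copies t (cycle_graph (2 * l + 1))) r ->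
  exists (H A : {set V}) (y : V -> R),
    [/\ perron_pair G r y /\ (forall v, 0 < y v), #|H| = (t - 1)%N, [disjoint H & A] &
      forall u v, u \notin H -> v \notin H -> adj G u v -> (u \in A) != (v \in A)].
Proof.
move=> t0 l0 nbig Gfree px bound; move: nbig; rewrite /threshold.
move hE : (1000 * t)%N => h; move qE : (t * (2 * l + 1))%N => q.
move DE : (10 * (2 * l + 1) * h)%N => D; move tauE : (q + D * (40 * q))%N => tau nbig.
have q0 : (0 < q)%N by rewrite -qE muln_gt0 t0 addn1.
have D0 : (0 < D)%N by rewrite -DE -hE !muln_gt0 addn1.
have tau_n : (1000 * tau <= #|V|)%N.
  by apply: leq_trans nbig; rewrite leq_mul2r -hE leq_pmulr ?orbT // muln_gt0.
have q_tau : (q + 40 * q <= tau)%N by rewrite -tauE leq_add2l leq_pmull.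
have n0 : (0 < #|V|)%N by move: q0 q_tau tau_n; clear; lia.
have nr := half_le_spectral_bound t0 l0 n0 bound.
have qr : 3 * q%:R + 1 <= r.
  have : 7 * q%:R + 3 <= #|V|%:R :> R.
    by rewrite -natrM -natrD ler_nat; move: q0 q_tau tau_n; clear; lia.
  have : 0 <= q%:R :> R by [].
  by move: nr; lra.
have := bipartite_approximation t0 l0 n0 Gfree px nr; rewrite /= qE => /(_ qr).
move=> [A [B [dAB cAB eAB]]].
have [|A0 [B0 [d0 c0 dense0 bigA bigB]]] := dense_core D0 _ dAB cAB eAB.
  apply: leq_trans tau_n; rewrite -mulnA -tauE mulnDr.
  by rewrite (leq_trans _ (leq_addl _ _)) // leq_mul2r orbT.
rewrite tauE in c0.
move/esym in hE; move/esym in qE; move/esym in DE; move/esym in tauE.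
have hq : (#|hubs G h A0 B0| <= q)%N.
  apply: leq_trans (ltnW (card_hubs t0 l0 hE qE DE tauE nbig Gfree d0 c0 dense0 bigA bigB)) _.
  by rewrite qE leq_pmulr // addn1.
(* The exceptional set of this normalisation is the set of hubs, no longer the vertices of a maximal
   packing. *)
have [y [v [py vh yv yoff y3]]] := perron_normalize px hq nr qr.
exists (hubs G h A0 B0), (sideA G h A0 B0), y; split.
- split=> // u; apply: lt_le_trans
    (half_le_weight t0 l0 hE qE DE tauE nbig Gfree py bound d0 c0 dense0 bigA bigB
       vh yv yoff y3 u).
  by lra.
- exact: (card_hubs_eq t0 l0 hE qE DE tauE nbig Gfree py bound d0 c0 dense0 bigA bigB
       vh yv yoff y3).
- by apply/pred0P => u /=; rewrite [X in _ && X]in_set andbA andbN.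
move=> u w uh wh uw; apply/negP => /eqP e.
have := no_inner t0 l0 hE qE DE tauE nbig Gfree py bound d0 c0 dense0 bigA bigB
       vh yv yoff y3 u w.
rewrite /inner uw !in_setC !in_setU (negbTE uh) (negbTE wh) e /=.
by case: (_ \in _).
Qed.

(** * Balancing complete multipartite graphs *)

Section Multipartite.
Variables (R : realFieldType) (V : finType) (H A : {set V}) (r : R).
Hypothesis r0 : 0 < r.

(* The parts are A, the complement of H and A, and the singletons of H. *)
Definition same_part : rel V :=
  fun u v => (u == v) || [&& u \notin H, v \notin H & (u \in A) == (v \in A)].

Lemma same_part_refl : reflexive same_part.
Proof. by move=> u; rewrite /same_part eqxx. Qed.

Lemma same_part_sym : symmetric same_part.
Proof. by move=> u v; rewrite /same_part eq_sym (eq_sym (u \in A)) andbCA. Qed.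

Lemma same_part_trans : transitive same_part.
Proof.
move=> v u w; rewrite /same_part => /orP[/eqP->//|/and3P[uH vH /eqP uv]].
move=> /orP[/eqP<-|/and3P[_ wH /eqP vw]]; apply/orP; right.
  by rewrite uH vH uv eqxx.
by rewrite uH wH uv vw eqxx.
Qed.

Definition multipartite : sgraph V := sgraph_of_rel (fun u v => ~~ same_part u v).

Lemma adj_multipartite u v : adj multipartite u v = ~~ same_part u v.
Proof.
rewrite adj_of_rel (same_part_sym v) orbb andb_idl //.
by apply: contraNneq => ->; rewrite same_part_refl.
Qed.

Lemma multipartite_free (t l : nat) : (0 < l)%N -> (#|H| < t)%N ->
  Defs.free (copies t (cycle_graph (2 * l + 1))) multipartite.
Proof.
move=> l0 Ht; apply: (@bicolored_outside_free _ _ (fun u => u \in A) H) => //.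
move=> u v uH vH; rewrite adj_multipartite /same_part uH vH /= negb_or => /andP[_].
by [].
Qed.

Definition part_size (u : V) : nat := #|[set v | same_part u v]|.

(** Up to scaling the Perron entry of a vertex in a part of size [s]: from [r * y u = S - s * y u]
    one gets [y u = S / (r + s)]. *)
Definition part_weight (u : V) : R := (r + (part_size u)%:R)^-1.

Lemma part_size_same u v : same_part u v -> part_size u = part_size v.
Proof.
move=> uv; apply: eq_card => w; rewrite !inE; apply/idP/idP.
  by apply: same_part_trans; rewrite same_part_sym.
exact: same_part_trans.
Qed.

Lemma sum_same_part (f : V -> R) u : (forall v, same_part u v -> f v = f u) ->
  \sum_(v | same_part u v) f v = (part_size u)%:R * f u.
Proof.
move=> fE; rewrite (eq_bigr (fun=> f u)) // sumr_const mulr_natl; congr (_ *+ _).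
by apply: eq_card => v; rewrite inE.
Qed.

Lemma part_weight_eq u : r * part_weight u + (part_size u)%:R * part_weight u = 1.
Proof. by rewrite -mulrDl mulfV // gt_eqF // ltr_wpDr. Qed.

Lemma sum_not_same (f : V -> R) u :
  \sum_(v | adj multipartite u v) f v = \sum_v f v - \sum_(v | same_part u v) f v.
Proof.
rewrite [X in _ = X - _](bigID (same_part u)) /= addrAC subrr add0r.
by apply: eq_bigl => v; rewrite adj_multipartite.
Qed.

(** As [(r + s) * part_weight u = 1], the neighbour sum at [u] is [T - 1 + r * part_weight u]. *)
Lemma quad_multipartite (T := \sum_u part_weight u) :
  quad (adj multipartite) part_weight =
  T * (T - 1) + r * \sum_u part_weight u ^+ 2.
Proof.
rewrite /quad (eq_bigr (fun u => part_weight u * (T - 1) + r * part_weight u ^+ 2)).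
  by rewrite big_split /= -mulr_suml -mulr_sumr.
move=> u _; rewrite -mulr_sumr sum_not_same sum_same_part; last first.
  by move=> v uv; rewrite /part_weight (part_size_same uv).
rewrite -/T; have := part_weight_eq u; set s := _%:R * _ => e.
have -> : s = 1 - r * part_weight u by rewrite -e; ring.
by ring.
Qed.

(** The spectral bound reduces to [T * (T - 1) <= 0] with [T > 0]. *)
Lemma part_weight_sum_le1 (U : finType) (F : sgraph U) : (0 < #|V|)%N ->
  spectral_bound V F r -> Defs.free F multipartite -> \sum_u part_weight u <= 1.
Proof.
move=> V0 bound free; have := bound _ part_weight free.
rewrite quad_multipartite gerDr.
have w0 u : 0 < part_weight u by rewrite invr_gt0 ltr_wpDr.
have : 0 < \sum_u part_weight u.
  have [v _] : exists v, v \in V by apply/card_gt0P.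
  by rewrite (bigD1 v) //= ltr_wpDr ?w0 // sumr_ge0 // => u _; rewrite ltW.
by move=> T0; rewrite pmulr_rle0 // subr_le0.
Qed.

Lemma part_weight_sum_eq1 (y : V -> R) : (0 < #|V|)%N ->
  perron_pair multipartite r y -> (forall v, 0 < y v) -> \sum_u part_weight u = 1.
Proof.
move=> V0 [_ _ eig] y0; set S := \sum_u y u.
have yE u : y u = S * part_weight u.
  have e w : r * y w = S - \sum_(v | same_part w v) y v.
    by rewrite -eig sum_not_same.
  have yc v : same_part u v -> y v = y u.
    move=> uv; apply: (mulfI (lt0r_neq0 r0)); rewrite !e; congr (_ - _).
    apply: eq_bigl => w; apply/idP/idP; first exact: same_part_trans.
    by apply: same_part_trans; rewrite same_part_sym.
  have := e u; rewrite (sum_same_part yc) => eu.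
  have -> : S = (r + (part_size u)%:R) * y u by rewrite mulrDl eu subrK.
  by rewrite /part_weight mulrAC mulfV ?mul1r // gt_eqF // ltr_wpDr.
have S0 : 0 < S.
  have [v _] : exists v, v \in V by apply/card_gt0P.
  by rewrite /S (bigD1 v) //= ltr_wpDr // sumr_ge0 // => u _; rewrite ltW.
apply: (mulfI (lt0r_neq0 S0)); rewrite mulr1 mulr_sumr.
by apply: eq_bigr => u _.
Qed.

Hypothesis dHA : [disjoint H & A].

Lemma part_weight_sumE :
  \sum_u part_weight u = #|H|%:R / (r + 1) + #|A|%:R / (r + #|A|%:R) +
    #|~: (H :|: A)|%:R / (r + #|~: (H :|: A)|%:R).
Proof.
have AH u : u \in A -> u \notin H by move=> uA; rewrite (disjointFl dHA).
rewrite (bigID (mem H)) /= [X in _ + X = _](bigID (mem A)) /= addrA; congr (_ + _ + _).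
- rewrite (eq_bigr (fun=> (r + 1)^-1)) ?sumr_const ?mulr_natl // => u uH.
  rewrite /part_weight /part_size (_ : [set v | _] = [set u]) ?cards1 //.
  by apply/setP => v; rewrite !inE /same_part uH /= orbF eq_sym.
- rewrite (eq_bigl (fun u => u \in A)) => [|u]; last by rewrite /= andb_idl //; apply: AH.
  rewrite (eq_bigr (fun=> (r + #|A|%:R)^-1)) ?sumr_const ?mulr_natl // => u uA.
  rewrite /part_weight /part_size (_ : [set v | _] = A) //.
  apply/setP => v; rewrite !inE /same_part uA (AH _ uA) /=.
  have [<-|_] := eqVneq u v; first by rewrite uA.
  by have := AH v; case: (v \in A) => [->|]; rewrite ?andbF.
rewrite (eq_bigl (fun u => u \in ~: (H :|: A))) => [|u]; last by rewrite !inE negb_or.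
rewrite (eq_bigr (fun=> (r + #|~: (H :|: A)|%:R)^-1)) ?sumr_const ?mulr_natl // => u.
rewrite !inE negb_or => /andP[uH uA].
rewrite /part_weight /part_size (_ : [set v | _] = ~: (H :|: A)) //.
apply/setP => v; rewrite !inE /same_part uH (negbTE uA) negb_or /=.
have [<-|_] := eqVneq u v; first by rewrite uA uH.
by case: (v \in A).
Qed.

End Multipartite.

(** The increment of [s / (r + s)] from [s] to [s + 1] is [r / ((r + s) * (r + s + 1))], which
    decreases in [s]. *)
Lemma balancing_gain (R : realFieldType) (r : R) (a b : nat) : 0 < r -> (a.+2 <= b)%N ->
  a%:R / (r + a%:R) + b%:R / (r + b%:R) <
  a.+1%:R / (r + a.+1%:R) + b.-1%:R / (r + b.-1%:R).
Proof.
move=> r0; case: b => // b; rewrite ltnS /= -!natr1 -(ltr_nat R).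
have : 0 <= a%:R :> R by [].
move: (a%:R : R) (b%:R : R) => x y x0 xy.
have h1 : (x + 1) / (r + (x + 1)) - x / (r + x) = r / ((r + x) * (r + (x + 1))).
  by field; apply/andP; split; apply/eqP; lra.
have h2 : (y + 1) / (r + (y + 1)) - y / (r + y) = r / ((r + y) * (r + (y + 1))).
  by field; apply/andP; split; apply/eqP; lra.
have : r / ((r + y) * (r + (y + 1))) < r / ((r + x) * (r + (x + 1))).
  rewrite ltr_pM2l // ltf_pV2 ?posrE; first nra.
    by apply: mulr_gt0; lra.
  by apply: mulr_gt0; lra.
rewrite -h1 -h2; lra.
Qed.

(** Moving a vertex from a side larger by two or more would push the sum of part weights above 1,
    although the new graph is still free. *)
Lemma multipartite_balanced (R : realFieldType) (V : finType) (H A : {set V})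
    (r : R) (y : V -> R) (t l : nat) : (0 < l)%N -> (0 < #|V|)%N -> 0 < r ->
  (#|H| < t)%N -> [disjoint H & A] ->
  spectral_bound V (copies t (cycle_graph (2 * l + 1))) r ->
  perron_pair (multipartite H A) r y -> (forall v, 0 < y v) ->
  (#|A| <= #|~: (H :|: A)|.+1)%N /\ (#|~: (H :|: A)| <= #|A|.+1)%N.
Proof.
move=> l0 V0 r0 Ht dHA bound py y0.
have eq1 := part_weight_sum_eq1 r0 V0 py y0.
rewrite (part_weight_sumE r dHA) in eq1.
have le1 (A' : {set V}) : [disjoint H & A'] -> #|H|%:R / (r + 1) + #|A'|%:R / (r + #|A'|%:R) +
    #|~: (H :|: A')|%:R / (r + #|~: (H :|: A')|%:R) <= 1.
  move=> dHA'; rewrite -(part_weight_sumE r dHA').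
  exact: part_weight_sum_le1 V0 bound (multipartite_free _ l0 Ht).
split; rewrite leqNgt; apply/negP => lt.
  have [w wA] : exists w, w \in A by apply/card_gt0P; apply: leq_trans lt.
  have dHA' : [disjoint H & A :\ w] by apply: disjointWr (subsetDl _ _) dHA.
  have := le1 _ dHA'.
  have cA : #|A :\ w| = #|A|.-1 by rewrite (cardsD1 w A) wA.
  have cB : #|~: (H :|: A :\ w)| = #|~: (H :|: A)|.+1.
    rewrite (cardsD1 w) !inE eqxx /= (disjointFl dHA wA) /= add1n; congr _.+1.
    apply: eq_card => u; rewrite !inE; have [->|//] := eqVneq u w.
    by rewrite wA orbT.
  rewrite cA cB; have := balancing_gain r0 lt; move: eq1; lra.
have [w wB] : exists w, w \in ~: (H :|: A) by apply/card_gt0P; apply: leq_trans lt.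
move: (wB); rewrite !inE negb_or => /andP[wH wA].
have dHA' : [disjoint H & w |: A].
  apply/pred0P => u /=; rewrite in_setU1; have [->|_] := eqVneq u w.
    by rewrite (negbTE wH).
  exact: (pred0P dHA u).
have := le1 _ dHA'.
have cA : #|w |: A| = #|A|.+1 by rewrite cardsU1 wA.
have cB : #|~: (H :|: (w |: A))| = #|~: (H :|: A)|.-1.
  rewrite [in RHS](cardsD1 w) wB /=; apply: eq_card => u; rewrite !inE.
  by case: (u == w); rewrite ?orbT.
rewrite cA cB; have := balancing_gain r0 lt; move: eq1; lra.
Qed.

(** * Identification with the join of a clique and a balanced complete bipartite graph *)

Lemma iso_join_bipartite (V : finType) (G : sgraph V) (H P Q : {set V}) (p a b : nat) :
  #|H| = p -> #|P| = a -> #|Q| = b ->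
  [disjoint H & P] -> Q = ~: (H :|: P) ->
  (forall u v, adj G u v = ~~ same_part H P u v) ->
  sgraph_iso G (join (complete_graph p) (complete_bipartite a b)).
Proof.
move=> <- <- <- dHP QE adjE.
pose g (z : 'I_#|H| + ('I_#|P| + 'I_#|Q|)) : V :=
  match z with
  | inl i => enum_val i | inr (inl i) => enum_val i | inr (inr i) => enum_val i
  end.
have gH i : g (inl i) \in H by exact: enum_valP.
have gP i : g (inr (inl i)) \in P by exact: enum_valP.
have gQ i : g (inr (inr i)) \in Q by exact: enum_valP.
have PH u : u \in P -> (u \in H) = false by move=> uP; rewrite (disjointFl dHP).
have QH u : u \in Q -> (u \in H) = false by rewrite QE !inE => /norP[/negbTE].
have QP u : u \in Q -> (u \in P) = false by rewrite QE !inE => /norP[_ /negbTE].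
have ginj : injective g.
  move=> [i|[i|i]] [j|[j|j]] e.
  - by rewrite (enum_val_inj e).
  - by have := PH _ (gP j); rewrite -e gH.
  - by have := QH _ (gQ j); rewrite -e gH.
  - by have := PH _ (gP i); rewrite e gH.
  - by rewrite (enum_val_inj e).
  - by have := QP _ (gQ j); rewrite -e gP.
  - by have := QH _ (gQ i); rewrite e gH.
  - by have := QP _ (gQ i); rewrite e gP.
  - by rewrite (enum_val_inj e).
have gbij : bijective g.
  apply: inj_card_bij ginj _; rewrite !card_sum !card_ord addnA.
  have -> : (#|H| + #|P|)%N = #|H :|: P|.
    by rewrite -cardsUI (disjoint_setI0 dHP) cards0 addn0.
  by rewrite QE cardsC.
have [f gK fK] := gbij.
exists f; first by exists g.
move=> u v; rewrite -[u]fK -[v]fK !gK; move: (f u) (f v) => {u v} z w.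
rewrite adjE /same_part inj_eq //.
case: z => [i|[i|i]]; case: w => [j|[j|j]];
  rewrite !adj_of_rel ?gH ?gP ?gQ ?(PH _ (gP _)) ?(QH _ (gQ _)) ?(QP _ (gQ _)) /=;
  rewrite ?orbF ?eqxx ?orbT //=;
  rewrite ?andbF //=.
by have [->|ij] := eqVneq i j; rewrite ?eqxx // !andbT.
Qed.

Lemma extremal_iso (R : realFieldType) (V : finType) (G : sgraph V)
    (r : R) (x : V -> R) (t l : nat) : (0 < t)%N -> (0 < l)%N ->
  (threshold t l <= #|V|)%N ->
  Defs.free (copies t (cycle_graph (2 * l + 1))) G -> perron_pair G r x ->
  spectral_bound V (copies t (cycle_graph (2 * l + 1))) r ->
  sgraph_iso G (join (complete_graph (t - 1)) (turan2 (#|V| - t + 1))).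
Proof.
move=> t0 l0 nbig Gfree px bound.
have [H [A [y [[py y0] cH dHA cross]]]] := bipartite_outside_hubs t0 l0 nbig Gfree px bound.
have nt : (1000 * (1000 * t) <= #|V|)%N.
  apply: leq_trans nbig; rewrite /threshold leq_pmulr // addn_gt0 muln_gt0 t0 addn1.
  by [].
have n_t : (t <= #|V|)%N by move: nt; clear; lia.
have V0 := leq_trans t0 n_t.
have Ht : (#|H| < t)%N by rewrite cH; move: t0; clear; lia.
have r0 : 0 < r.
  have : 2 <= #|V|%:R :> R by rewrite ler_nat; move: t0 nt; clear; lia.
  by have := half_le_spectral_bound t0 l0 V0 bound; lra.
pose M := multipartite H A.
have GM u v : adj G u v -> adj M u v.
  move=> uv; rewrite adj_multipartite /same_part negb_or; apply/andP; split.
    by apply: contraTneq uv => ->; rewrite adj_irrefl.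
  by apply/negP => /and3P[uH vH]; apply/negP; apply: cross.
have leM w z : (adj G w z)%:R * (y w * y z) <= (adj M w z)%:R * (y w * y z).
  rewrite ler_wpM2r //; first by rewrite mulr_ge0 // ltW.
  by rewrite ler_nat; have := GM w z; case: (adj G w z) => // ->.
(* The multipartite graph [M] contains [G] and is free; a pair adjacent only in [M] would raise the
   form by at least [y u * y v > 0], past the bound. *)
have adjE u v : adj G u v = adj M u v.
  apply/idP/idP => [/GM //|uv]; apply: contraT => nuv.
  have := bound M y (multipartite_free _ l0 Ht).
  rewrite -(quad_perron py) !quadE leNgt => /negP[].
  rewrite (bigD1 u) //= [X in _ < X](bigD1 u) //= ltr_leD //; last first.
    apply: ler_sum => w _; apply: ler_sum => z _.
    exact: leM.
  rewrite (bigD1 v) //= [X in _ < X](bigD1 v) //= ltr_leD //.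
    by rewrite (negbTE nuv) uv mul0r mul1r mulr_gt0.
  apply: ler_sum => z _.
  exact: leM.
have pM : perron_pair M r y.
  have [h1 h2 eig] := py; split=> // v; rewrite -eig.
  by apply: eq_bigl => u; rewrite adjE.
have [AB BA] := multipartite_balanced l0 V0 r0 Ht dHA bound pM y0.
set B := ~: (H :|: A) in AB BA.
have cAB : (#|A| + #|B| = #|V| - t + 1)%N.
  have := cardsC (H :|: A); rewrite -/B => cV; move: n_t t0; rewrite -cV.
  have -> : #|H :|: A| = (#|H| + #|A|)%N.
    by rewrite -cardsUI (disjoint_setI0 dHA) cards0 addn0.
  by rewrite cH; move: #|A| #|B| => a b; clear; lia.
(* [turan2] lists the smaller part first, so the roles of [A] and [B] depend on their sizes. *)
rewrite /turan2; have [le|lt] := leqP #|A| #|B|.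
  apply: (iso_join_bipartite cH (P := A) (Q := B)) => //.
  - by rewrite -cAB; move: le BA; move: #|A| #|B| => a b; clear; lia.
  - by rewrite -cAB; move: le BA; move: #|A| #|B| => a b; clear; lia.
  - by move=> u v; rewrite adjE adj_multipartite.
apply: (iso_join_bipartite cH (P := B) (Q := A)) => //.
- by rewrite -cAB; move: lt AB; move: #|A| #|B| => a b; clear; lia.
- by rewrite -cAB; move: lt AB; move: #|A| #|B| => a b; clear; lia.
- by apply/pred0P => u /=; rewrite !inE; case: (u \in H).
- apply/setP => u; rewrite !inE; have := disjointFr dHA (x := u).
  by case: (u \in H) => [->|]; case: (u \in A).
move=> u v; rewrite adjE adj_multipartite /same_part !inE.
by case: (u \in H); case: (v \in H); case: (u \in A); case: (v \in A).
Qed.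

(** * Extremal graphs *)

Lemma rho_ge0 (V : finType) (G : sgraph V) : 0 <= rho G.
Proof. exact: spectral_radius_ge0. Qed.

Lemma contains_iso (U V W : finType) (F : sgraph U) (G : sgraph V) (K : sgraph W) :
  sgraph_iso G K -> contains F G -> contains F K.
Proof.
move=> [f fbij fadj] /existsP[g /andP[/injectiveP ginj gadj]].
apply/existsP; exists [ffun u => f (g u)]; apply/andP; split.
  by apply/injectiveP => u v; rewrite !ffunE => /(bij_inj fbij)/ginj.
apply/forallP => u; apply/forallP => v; rewrite !ffunE fadj.
by have /forallP/(_ u)/forallP/(_ v) := gadj.
Qed.

Lemma sgraph_iso_sym (V W : finType) (G : sgraph V) (K : sgraph W) :
  sgraph_iso G K -> sgraph_iso K G.
Proof.
move=> [f [g fK gK] fadj]; exists g; first by exists f.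
by move=> x y; rewrite -fadj !gK.
Qed.

Lemma free_iso (U V W : finType) (F : sgraph U) (G : sgraph V) (K : sgraph W) :
  sgraph_iso G K -> Defs.free F G = Defs.free F K.
Proof.
move=> GK; congr (~~ _); apply/idP/idP; first exact: contains_iso.
exact: contains_iso (sgraph_iso_sym GK).
Qed.

(** The Perron vector of [G], carried over to [K], is a test vector for the Rayleigh bound there. *)
Lemma rho_iso_le (V W : finType) (G : sgraph V) (K : sgraph W) :
  (0 < #|V|)%N -> sgraph_iso G K -> rho G <= rho K.
Proof.
move=> V0 [f fbij fadj]; have [g fK gK] := fbij.
have gbij : bijective g by exists f.
have [r [x [rE x0 [v xv] eig]]] := perron_vector G V0.
pose s := in_algR (ger0_real (rho_ge0 K)).
have := @quad_le_rho _ K s (fun w => x (g w)) erefl.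
have -> : quad (adj K) (fun w => x (g w)) = quad (adj G) x.
  rewrite /quad (reindex f) /=; last exact: onW_bij.
  apply: eq_bigr => u _; rewrite (reindex f) /=; last exact: onW_bij.
  by apply: eq_big => [w|w _]; rewrite ?fadj ?fK.
have -> : \sum_w x (g w) ^+ 2 = \sum_u x u ^+ 2.
  by rewrite (reindex f) /=; [apply: eq_bigr => u _; rewrite fK | exact: onW_bij].
rewrite (@quad_perron _ _ G r x); last by split=> //; exists v.
rewrite ler_pM2r; first by rewrite -rE.
by rewrite (bigD1 v) //= ltr_pwDl ?exprn_even_gt0 //= sumr_ge0 // => u _; rewrite sqr_ge0.
Qed.

Lemma rho_iso (V W : finType) (G : sgraph V) (K : sgraph W) :
  (0 < #|V|)%N -> sgraph_iso G K -> rho G = rho K.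
Proof.
move=> V0 GK; apply/le_anti; rewrite rho_iso_le // rho_iso_le //.
  by have [f fbij _] := GK; rewrite -(bij_eq_card fbij).
exact: sgraph_iso_sym.
Qed.

(** Needed because [spex] ranges over graphs on ['I_n], while an extremal graph may live on any
    vertex type of size [n]. *)
Lemma transport_graph (V W : finType) (G : sgraph V) : #|V| = #|W| ->
  exists K : sgraph W, sgraph_iso G K.
Proof.
move=> cVW; pose f (v : V) : W := enum_val (cast_ord cVW (enum_rank v)).
pose g (w : W) : V := enum_val (cast_ord (esym cVW) (enum_rank w)).
have fK : cancel f g by move=> v; rewrite /f /g enum_valK cast_ordK enum_rankK.
have gK : cancel g f by move=> v; rewrite /f /g enum_valK cast_ordKV enum_rankK.
exists (sgraph_of_rel (fun i j => adj G (g i) (g j))); exists f; first by exists g.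
move=> x y; rewrite adj_of_rel !fK (adj_sym G y) orbb (inj_eq (can_inj fK)).
by rewrite andb_idl //; apply: contraTneq => ->; rewrite adj_irrefl.
Qed.

Lemma rho_le_spex (n : nat) (U V : finType) (F : sgraph U) (G : sgraph V) :
  (0 < n)%N -> #|V| = n -> Defs.free F G -> rho G <= spex n F.
Proof.
move=> n0 cV Gfree; have [|K GK] := @transport_graph V 'I_n G; first by rewrite card_ord.
rewrite (rho_iso _ GK) ?cV //.
apply: (le_bigmax_algC (F := fun K => rho K) (fun K => rho_ge0 K)).
  exact: mem_index_enum.
by rewrite -(free_iso _ GK).
Qed.

Lemma extremal_spectral_bound (n : nat) (U V : finType) (F : sgraph U) (G : sgraph V)
    (r : algR) : (0 < n)%N -> extremal n F G -> algRval r = rho G -> spectral_bound V F r.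
Proof.
move=> n0 [cV _ Gs] rE K y Kfree; pose s := in_algR (ger0_real (rho_ge0 K)).
apply: le_trans (@quad_le_rho _ K s y erefl) _.
apply: ler_wpM2r; first by apply: sumr_ge0 => v _; rewrite sqr_ge0.
suff: rho K <= algRval r by [].
by rewrite rE Gs rho_le_spex.
Qed.

Lemma extremal_exists (n t l : nat) : (0 < t)%N -> (0 < l)%N ->
  exists G : sgraph 'I_n, extremal n (copies t (cycle_graph (2 * l + 1))) G.
Proof.
move=> t0 l0; set F := copies _ _.
(* With both sets empty there is a single part: the edgeless graph shows that the maximum is over a
   nonempty family. *)
have free0 : Defs.free F (multipartite (set0 : {set 'I_n}) set0).
  by apply: multipartite_free; rewrite ?cards0.
have [G /andP[_ Gfree] GE] := bigmax_attained (P := Defs.free F)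
  (F := fun K => rho K) (fun K => rho_ge0 K)
  (mem_index_enum (multipartite (set0 : {set 'I_n}) set0)) free0.
by exists G; split; rewrite ?card_ord // /spex GE.
Qed.

Local Open Scope nat_scope.

Theorem theorem1p2 :
  forall t l : nat, 0 < t -> 0 < l ->
  exists n0 : nat, forall n : nat, n0 <= n ->
    let F := copies t (cycle_graph (2 * l + 1)) in
    let G0 := join (complete_graph (t - 1)) (turan2 (n - t + 1)) in
    extremal n F G0 /\
    forall (V : finType) (G : sgraph V), extremal n F G -> sgraph_iso G G0.
Proof.
(* The successor guarantees [0 < n], as Perron vectors require. *)
move=> t l t0 l0; exists (threshold t l).+1 => n nbig F G0.
have n0 : 0 < n by apply: leq_trans nbig.
have iso (V : finType) (G : sgraph V) : extremal n F G -> sgraph_iso G G0.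
  move=> Gext; have [cV Gfree _] := Gext.
  have [|r [x [rE x0 xN eig]]] := perron_vector G; first by rewrite cV.
  have bound := extremal_spectral_bound n0 Gext rE.
  rewrite /G0 -cV; apply: (extremal_iso t0 l0 _ Gfree _ bound (x := x)) => //.
  by rewrite cV ltnW.
(* Some extremal graph exists; it is isomorphic to [G0] by the uniqueness part, so [G0] inherits its
   extremality. *)
split=> //; have [G Gext] := extremal_exists n t0 l0.
have GG0 := iso _ _ Gext; have [cV Gfree Gs] := Gext.
have [f fbij _] := GG0; split.
- by rewrite -(bij_eq_card fbij) card_ord.
- by rewrite -(free_iso _ GG0).
- by rewrite -(rho_iso _ GG0) // cV.
Qed.
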